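(* Let $n\ge 3$ and let $\Gamma\subset\mathbb{R}^n$ be an open convex symmetric cone with vertex at the origin such that $\{\lambda:\lambda_i>0,\ 1\le i\le n\}\subset\Gamma\subset\{\lambda:\sum_{i=1}^n\lambda_i>0\}$. Assume that $(1,0,\ldots,0)\notin\partial\Gamma$ and $0\le\mu_\Gamma^+<1$. Let $u\in LSC(B_1\setminus\{0\})\cap L^\infty_{\rm loc}(B_1\setminus\{0\})$ be a positive viscosity solution of $\lambda(A^u)\in\bar\Gamma$ in $B_1\setminus\{0\}$. Then $u\in C^{0,1-\mu_\Gamma^+}_{\rm loc}(B_1\setminus\{0\})$ and \[ \lim_{|x|\to 0}|x|^{n-2}u(x)=a\in[0,+\infty) \] (the limit exists and is finite). In addition, if $a=0$ then $u$, extended by $u(0)=\liminf_{|x|\to0}u(x)$, belongs to $C^{0,1-\mu_\Gamma^+}_{\rm loc}(B_1)$ and \[ \Big\|u^{\frac{\mu_\Gamma^+-1}{n-2}}\Big\|_{C^{0,1-\mu_\Gamma^+}(B_{1/2})}\le C(\Gamma)\,\sup_{\partial B_{3/4}}u^{\frac{\mu_\Gamma^+-1}{n-2}}, \] where $C(\Gamma)$ depends only on $\Gamma$.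
   Context: $B_r$ is the open ball of radius $r$ centered at the origin in $\mathbb{R}^n$; $LSC(\Omega)$ is the set of real-valued lower semicontinuous functions on $\Omega$. ''Symmetric'' means invariant under permutations of coordinates. For a positive $C^2$ function $u$, $A^u$ is the symmetric matrix with entries \[ (A^u)_{ij}=-\frac{2}{n-2}u^{-\frac{n+2}{n-2}}\nabla_{ij}u+\frac{2n}{(n-2)^2}u^{-\frac{2n}{n-2}}\nabla_iu\nabla_ju-\frac{2}{(n-2)^2}u^{-\frac{2n}{n-2}}|\nabla u|^2\delta_{ij}, \] and $\lambda(A^u)$ denotes its eigenvalues. Viscosity sense. Let $\Omega\subset\mathbb{R}^n$ be open. A positive function $u\in LSC(\Omega)$ satisfies $\lambda(A^u)\in\bar\Gamma$ in $\Omega$ in the viscosity sense if for any $x_0\in\Omega$ and $\varphi\in C^2(\Omega)$ with $(u-\varphi)(x_0)=0$ and $u-\varphi\ge 0$ near $x_0$, one has $\lambda(A^\varphi(x_0))\in\bar\Gamma$. The constant $\mu_\Gamma^+\in[0,n-1]$ is the unique number such that $(-\mu_\Gamma^+,1,\ldots,1)\in\partial\Gamma$. *)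

(* Defs.v *)
From HB Require Import structures.
From mathcomp Require Import all_boot all_order all_algebra all_fingroup.
From mathcomp Require Import all_classical all_reals all_analysis.
Set Implicit Arguments.
Unset Strict Implicit.
Unset Printing Implicit Defensive.
Import Order.TTheory GRing.Theory Num.Theory.
Import numFieldNormedType.Exports.
Local Open Scope classical_set_scope.
Local Open Scope ring_scope.

(* The library norm on 'rV[R]_n is the sup norm (same topology); balls, limits
   and Hoelder quotients below need the Euclidean norm. *)
Definition enorm (R : realType) (n : nat) (x : 'rV[R]_n) : R :=
  Num.sqrt (\sum_(i < n) x 0 i ^+ 2).

Definition eball (R : realType) (n : nat) (r : R) : set 'rV[R]_n :=
  [set x | enorm x < r].

Definition esphere (R : realType) (n : nat) (r : R) : set 'rV[R]_n :=
  [set x | enorm x = r].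

Definition topo_boundary (T : topologicalType) (A : set T) : set T :=
  closure A `\` interior A.

Definition open_convex_symmetric_cone (R : realType) (n : nat)
    (Gamma : set 'rV[R]_n) : Prop :=
  [/\ open Gamma,
      convex_set (Gamma : set (convex_lmodType 'rV[R]_n)),
      (forall (t : R) (x : 'rV[R]_n), 0 < t -> Gamma x -> Gamma (t *: x)) &
      (forall (s : 'S_n) (x : 'rV[R]_n), Gamma x -> Gamma (col_perm s x))].

(* mu is the constant mu_Gamma^+; since Gamma is open and convex and contains
   (1, ..., 1), at most one mu satisfies this. *)
Definition is_mu_plus (R : realType) (n : nat) (Gamma : set 'rV[R]_n)
    (mu : R) : Prop :=
  0 <= mu <= n%:R - 1 /\
  topo_boundary Gamma (\row_(j < n) (if j == 0%N :> nat then - mu else 1)).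

Definition partial (R : realType) (n : nat) (i : 'I_n) (f : 'rV[R]_n -> R)
    : 'rV[R]_n -> R :=
  fun x => 'D_(delta_mx 0 i) f x.

Definition C2_on (R : realType) (n : nat) (Omega : set 'rV[R]_n)
    (f : 'rV[R]_n -> R) : Prop :=
  forall x, Omega x ->
    [/\ {for x, continuous f},
        (forall i : 'I_n, derivable f x (delta_mx 0 i)
                          /\ {for x, continuous (partial i f)}) &
        (forall i j : 'I_n, derivable (partial j f) x (delta_mx 0 i)
                            /\ {for x, continuous (partial i (partial j f))})].

Definition A_mx (R : realType) (n : nat) (f : 'rV[R]_n -> R) (x : 'rV[R]_n)
    : 'M[R]_n :=
  let N : R := n%:R in
  \matrix_(i, j)
    (- (2 / (N - 2)) * f x `^ (- ((N + 2) / (N - 2)))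
       * partial i (partial j f) x
     + 2 * N / (N - 2) ^+ 2 * f x `^ (- (2 * N / (N - 2)))
       * partial i f x * partial j f x
     - 2 / (N - 2) ^+ 2 * f x `^ (- (2 * N / (N - 2)))
       * (\sum_(k < n) partial k f x ^+ 2) * (i == j)%:R).

(* lambda(A) \in S, the eigenvalues being counted with multiplicity; their
   order is irrelevant for the permutation invariant S used here. *)
Definition eigenvalues_in (R : realType) (n : nat) (A : 'M[R]_n)
    (S : set 'rV[R]_n) : Prop :=
  exists lam : 'rV[R]_n,
    char_poly A = \prod_(i < n) ('X - (lam 0 i)%:P) /\ S lam.

(* For x outside Omega the subspace neighborhoods of x contain {x}, so this
   only constrains u on Omega. *)
Definition LSC_on (R : realType) (n : nat) (Omega : set 'rV[R]_n)
    (u : 'rV[R]_n -> R) : Prop :=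
  lower_semicontinuous (fun x : subspace Omega => (u x)%:E).

Definition viscosity_sol (R : realType) (n : nat) (Gamma Omega : set 'rV[R]_n)
    (u : 'rV[R]_n -> R) : Prop :=
  forall (x0 : 'rV[R]_n) (phi : 'rV[R]_n -> R),
    Omega x0 -> C2_on Omega phi ->
    u x0 - phi x0 = 0 -> (\forall x \near x0, 0 <= u x - phi x) ->
    eigenvalues_in (A_mx phi x0) (closure Gamma).

(* The library has no Lebesgue measure on R^n; its null sets are the sets
   with coverings by countably many boxes of arbitrarily small total volume. *)
Definition lebesgue_null (R : realType) (n : nat) (N : set 'rV[R]_n) : Prop :=
  forall e : R, 0 < e -> exists a b : nat -> 'rV[R]_n,
    [/\ (forall k i, a k 0 i <= b k 0 i),
        N `<=` \bigcup_k [set x | forall i, a k 0 i <= x 0 i <= b k 0 i] &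
        (\sum_(0 <= k <oo) (\prod_(i < n) (b k 0 i - a k 0 i))%:E <= e%:E)%E].

(* Measurability is not required here: it is only used together with LSC_on,
   which implies it. *)
Definition Linfty_loc (R : realType) (n : nat) (Omega : set 'rV[R]_n)
    (u : 'rV[R]_n -> R) : Prop :=
  forall K : set 'rV[R]_n, compact K -> K `<=` Omega ->
    exists M : R, lebesgue_null (K `&` [set x | M < `|u x|]).

(* The pairs p with p.1 = p.2 contribute 0 to the seminorm. *)
Definition holder_norm (R : realType) (n : nat) (alpha : R)
    (D : set 'rV[R]_n) (f : 'rV[R]_n -> R) : \bar R :=
  adde
    (ereal_sup [set `|f x|%:E | x in D])
    (ereal_sup [set (`|f p.1 - f p.2| / enorm (p.1 - p.2) `^ alpha)%:E
               | p in D `*` D]).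

Definition holder_loc (R : realType) (n : nat) (alpha : R)
    (Omega : set 'rV[R]_n) (f : 'rV[R]_n -> R) : Prop :=
  forall K : set 'rV[R]_n, compact K -> K `<=` Omega ->
    (holder_norm alpha K f < +oo)%E.

Definition extend0 (R : realType) (n : nat) (u : 'rV[R]_n -> R) (l : R)
    : 'rV[R]_n -> R :=
  fun x => if x == 0 then l else u x.

(* Main.v *)
(** Put k = (n - 2) / (1 - mu) and w = u^(-1/k) = u^((mu - 1)/(n - 2)), an upper
    semicontinuous function. For h = a + b |x - y|^(1 - mu) with a, b > 0 the matrix
    A of h^(-k) has eigenvalues proportional to (-mu, 1, ..., 1), which lies on the
    boundary of Gamma; lowering the exponent slightly pushes them out of the closure
    of Gamma. Hence w obeys a comparison principle with the functions h, exactly as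
    infinity-subharmonic functions enjoy comparison with cones. With the vertex at a
    point y <> 0 this is an interior Hoelder estimate for w; with the vertex at 0 it
    bounds w(x) by m + C |x|^(1 - mu), where m is the limit of the maxima of w over
    the spheres |x| = r. Moreover A has nonnegative trace, so u is superharmonic;
    this makes the sphere maxima of w monotone in r.

    A chain of Hoelder estimates along the sphere |x| = r, started at the point where
    w is maximal, gives the matching lower bound w(x) >= m - C |x|^(1 - mu), so that
    w extended by m at 0 is Hoelder near 0. If m > 0, then u is bounded near 0 and
    a = 0. If m = 0, the ratio of the maximum of w over |x| = r to r^(1 - mu) decreases
    to a limit L as r tends to 0; L > 0 by comparing u with multiples of |x|^(2 - n).
    If w(y) were much smaller than L |y|^(1 - mu) at some y close to 0, then u would be
    large on a ball around y, and comparing u with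
    c |x|^(2 - n) + A |x - y|^(2 - n) - const would make u too large on the whole
    sphere |x| = |y|. Hence |x|^(n - 2) u tends to a = L^(-k) > 0. *)

Require Import Defs.
From HB Require Import structures.
From mathcomp Require Import all_boot all_order all_algebra all_fingroup.
From mathcomp Require Import all_classical all_reals all_analysis.
From mathcomp Require Import ring lra.
Import Order.TTheory GRing.Theory Num.Theory.
Import numFieldNormedType.Exports.
Local Open Scope classical_set_scope.
Local Open Scope ring_scope.
Set Implicit Arguments.
Unset Strict Implicit.
Unset Printing Implicit Defensive.

(** * Euclidean inner product, norm and topology on row vectors *)

Section Euclid.
Context {R : realType} {n : nat}.
Implicit Types x y z : 'rV[R]_n.

Definition dot x y : R := \sum_(i < n) x 0 i * y 0 i.

Lemma dotC x y : dot x y = dot y x.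
Proof. by apply: eq_bigr => i _; rewrite mulrC. Qed.

Lemma dotDr x y z : dot x (y + z) = dot x y + dot x z.
Proof. by rewrite -big_split; apply: eq_bigr => i _; rewrite mxE mulrDr. Qed.

Lemma dotZr a x y : dot x (a *: y) = a * dot x y.
Proof. by rewrite mulr_sumr; apply: eq_bigr => i _; rewrite mxE; ring. Qed.

Lemma dotDl x y z : dot (y + z) x = dot y x + dot z x.
Proof. by rewrite dotC dotDr !(dotC x). Qed.

Lemma dotZl a x y : dot (a *: y) x = a * dot y x.
Proof. by rewrite dotC dotZr dotC. Qed.

Lemma dotNr x y : dot x (- y) = - dot x y.
Proof. by rewrite -scaleN1r dotZr mulN1r. Qed.

Lemma dot0r x : dot x 0 = 0.
Proof. by rewrite /dot big1// => i _; rewrite mxE mulr0. Qed.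

Lemma dot_ge0 x : 0 <= dot x x.
Proof. by apply: sumr_ge0 => i _; rewrite -expr2 sqr_ge0. Qed.

Lemma enormE x : enorm x = Num.sqrt (dot x x).
Proof. by congr Num.sqrt; apply: eq_bigr => i _; rewrite expr2. Qed.

Lemma enorm_sqr x : enorm x ^+ 2 = dot x x.
Proof. by rewrite enormE sqr_sqrtr// dot_ge0. Qed.

Lemma enorm_ge0 x : 0 <= enorm x.
Proof. exact: sqrtr_ge0. Qed.

Lemma enorm0 : enorm (0 : 'rV[R]_n) = 0.
Proof.
rewrite enormE [dot _ _]big1 ?sqrtr0// => i _; by rewrite mxE mul0r.
Qed.

Lemma coord_le_enorm x i : `|x 0 i| <= enorm x.
Proof.
rewrite -(@ler_pXn2r _ 2)// ?nnegrE ?enorm_ge0// enorm_sqr real_normK ?num_real//.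
rewrite /dot (bigD1 i)//= -expr2 lerDl; apply: sumr_ge0 => j _.
by rewrite -expr2 sqr_ge0.
Qed.

Lemma enorm_eq0 x : (enorm x == 0) = (x == 0).
Proof.
apply/idP/eqP => [/eqP x0|->]; last by rewrite enorm0.
apply/rowP => i; rewrite mxE; apply/eqP.
by rewrite -normr_le0 -x0 coord_le_enorm.
Qed.

Lemma enorm_gt0 x : (0 < enorm x) = (x != 0).
Proof. by rewrite lt_neqAle enorm_ge0 andbT eq_sym enorm_eq0. Qed.

Lemma dotNN x : dot (- x) (- x) = dot x x.
Proof. by rewrite dotNr dotC dotNr opprK. Qed.

Lemma enormN x : enorm (- x) = enorm x.
Proof. by rewrite !enormE dotNN. Qed.

Lemma enorm_distC x y : enorm (x - y) = enorm (y - x).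
Proof. by rewrite -opprB enormN. Qed.

Lemma enormZ a x : enorm (a *: x) = `|a| * enorm x.
Proof.
by rewrite !enormE dotZr dotZl mulrA -expr2 sqrtrM ?sqr_ge0// sqrtr_sqr.
Qed.

Lemma dot_sqrD x y : dot (x + y) (x + y) = dot x x + 2 * dot x y + dot y y.
Proof. by rewrite !(dotDr, dotDl) (dotC y x); ring. Qed.

(** Cauchy-Schwarz, from the nonnegative square of [enorm y *: x - enorm x *: y]. *)
Lemma dot_le_enorm x y : dot x y <= enorm x * enorm y.
Proof.
have [->|x0] := eqVneq x 0.
  by rewrite enorm0 mul0r /dot big1// => i _; rewrite mxE mul0r.
have [->|y0] := eqVneq y 0.
  by rewrite enorm0 mulr0 /dot big1// => i _; rewrite mxE mulr0.
have a0 : 0 < enorm x by rewrite enorm_gt0.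
have b0 : 0 < enorm y by rewrite enorm_gt0.
have := dot_ge0 (enorm y *: x + (- enorm x) *: y).
rewrite dot_sqrD !(dotZr, dotZl) -!enorm_sqr => h.
have : 0 <= 2 * (enorm x * enorm y) * (enorm x * enorm y - dot x y) by nra.
by rewrite pmulr_rge0 ?subr_ge0// !mulr_gt0.
Qed.

Lemma ler_enormD x y : enorm (x + y) <= enorm x + enorm y.
Proof.
rewrite -(@ler_pXn2r _ 2)// ?nnegrE ?enorm_ge0// ?addr_ge0 ?enorm_ge0//.
rewrite enorm_sqr dot_sqrD sqrrD !enorm_sqr mulr2n.
have := dot_le_enorm x y; lra.
Qed.

Lemma ler_enorm_dist x y : enorm x <= enorm (x - y) + enorm y.
Proof. by rewrite -{1}[x](subrK y) ler_enormD. Qed.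

Lemma enorm_continuous : continuous (@enorm R n).
Proof.
move=> x0; apply: (@continuous_comp _ _ _
  (fun x : 'rV[R]_n => \sum_(i < n) x 0 i ^+ 2) (@Num.sqrt R)); last exact: sqrt_continuous.
suff : continuous (fun x : 'rV[R]_n => \sum_(i < n) x 0 i ^+ 2) by exact.
apply: continuous_big => [|i _]; first exact: add_continuous.
move=> z; apply: (@cvgM _ _ (nbhs z) _ (fun x : 'rV[R]_n => x 0 i) (fun x => x 0 i));
  exact: coord_continuous.
Qed.

Lemma enorm_dist_continuous y : continuous (fun x => enorm (x - y)).
Proof.
move=> x; apply: (@cvg_comp _ _ _ (fun x : 'rV[R]_n => x - y) (@enorm R n) (nbhs x) (nbhs (x - y)) (nbhs (enorm (x - y)))).
  by apply: cvgB; [exact: cvg_id|exact: cvg_cst].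
exact: enorm_continuous.
Qed.

Lemma near_enorm x e : 0 < e -> \forall y \near x, enorm (y - x) < e.
Proof.
move=> e0; have := @enorm_dist_continuous x x.
rewrite /continuous_at subrr enorm0.
move=> /cvgrPdist_lt /(_ _ e0); apply: filterS => y.
by rewrite sub0r normrN ger0_norm// enorm_ge0.
Qed.

(** A Euclidean ball lies in the sup-norm ball of the same radius, and the Euclidean norm is
    continuous, so both norms give the same neighbourhoods. *)
Lemma nbhs_enorm x (U : set 'rV[R]_n) : nbhs x U <->
  exists2 e : R, 0 < e & forall y, enorm (y - x) < e -> U y.
Proof.
split=> [|[e e0 eU]]; last by apply: filterS (near_enorm x e0).
move=> /nbhs_ballP[e /= e0 eU]; exists e => // y ye; apply: eU.
split=> // i j; rewrite !ord1 /ball/= -[X in `|X|]opprK normrN opprB.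
by apply: le_lt_trans ye; have := coord_le_enorm (y - x) j; rewrite !mxE.
Qed.

Lemma enorm_closed_le y r : closed [set x | enorm (x - y) <= r].
Proof.
have -> : [set x | enorm (x - y) <= r] = (fun x => enorm (x - y)) @^-1` [set t | t <= r] by [].
by apply: preimage_closed => [x _|]; [exact: enorm_dist_continuous|exact: closed_le].
Qed.

Lemma enorm_closed_ge y r : closed [set x | r <= enorm (x - y)].
Proof.
have -> : [set x | r <= enorm (x - y)] = (fun x => enorm (x - y)) @^-1` [set t | r <= t] by [].
by apply: preimage_closed => [x _|]; [exact: enorm_dist_continuous|exact: closed_ge].
Qed.

Lemma enorm_compact (D : set 'rV[R]_n) (M : R) :
  closed D -> (forall x, D x -> enorm x <= M) -> compact D.
Proof.
move=> cD DM; apply: bounded_closed_compact => //.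
exists M; split; first exact: num_real.
move=> N MN x Dx; apply: le_trans (ltW MN); apply: le_trans (DM x Dx).
have -> : `|x| = mx_norm x by [].
have [->|] := eqVneq (mx_norm x) 0; first exact: enorm_ge0.
by move=> /mx_norm_neq0[[i j] ->]; rewrite ord1 coord_le_enorm.
Qed.

End Euclid.

(** * Minima of lower semicontinuous functions on compact sets *)

Lemma lsc_min (T : ptopologicalType) (R : realType) (D : set T) (f : T -> R) :
  D !=set0 -> compact D ->
  (forall x, D x -> forall a, a < f x -> \forall y \near x, a < f y) ->
  exists2 x, D x & forall y, D y -> f x <= f y.
Proof.
move=> [d0 Dd0] /compact_near_coveringP cD flsc; apply: contrapT => nomin.
have lower x : D x -> exists2 y, D y & f y < f x.
  move=> Dx; apply: contrapT => no; apply: nomin; exists x => // y Dy.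
  by rewrite leNgt; apply/negP => yx; apply: no; exists y.
(* The sets containing a nonempty sublevel piece of [f] on [D] form a filter. Without a minimum
   every point of [D] has a neighbourhood on which [f] exceeds some f(y), and compactness makes one
   y serve for all of [D], including y itself. *)
pose F : set_system T := [set A | exists2 y, D y & forall z, D z -> f z <= f y -> A z].
have FF : Filter F.
  split; first by exists d0.
    move=> A B [y Dy Ay] [z Dz Bz]; have [yz|zy] := leP (f y) (f z).
      exists y => // t Dt ty; split; [exact: Ay|apply: Bz => //].
      exact: le_trans yz.
    exists z => // t Dt ty; split; [apply: Ay|apply: Bz] => //.
    exact: le_trans (ltW zy).
  by move=> A B AB [y Dy Ay]; exists y => // z Dz zy; exact/AB/Ay.
have [|y Dy /(_ y Dy (lexx _)) /(_ y Dy)] := cD T F (fun i x => f i < f x) FF; last by rewrite ltxx.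
move=> x Dx; have [y Dy yx] := lower x Dx.
exists ([set t | f y < f t], [set z | f z <= f y]) => /=.
  split; first exact: flsc.
  by exists y.
by move=> [t z] /= [yt zy]; exact: le_lt_trans yt.
Qed.

(** * Quadratic polynomials as test functions *)

Lemma is_derive_quadratic (R : realType) (V : normedModType R) (f : V -> R) (x v : V) (a b : R) :
  (forall h, f (h *: v + x) = f x + h * a + h ^+ 2 * b) -> is_derive x v f a.
Proof.
move=> fE.
have cv : h^-1 *: (f (h *: v + x) - f x) @[h --> (0 : R)^'] --> a.
  apply: cvg_trans; first apply: (@near_eq_cvg _ _ _ _ (fun h => a + h * b)).
    near=> h; have h0 : h != 0 by near: h; exact: nbhs_dnbhs_neq.
    by rewrite fE /GRing.scale/=; field.
  have -> : nbhs a = nbhs (a + 0 * b) by rewrite mul0r addr0.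
  apply: cvg_within_filter.
  by apply: cvgD; [exact: cvg_cst|apply: cvgMl; exact: cvg_id].
by split; [exact/cvg_ex/ex_intro/cv|exact: cvg_lim cv].
Unshelve. all: by end_near. Qed.

Section QuadraticTest.
Context {R : realType} {n : nat}.
Implicit Types (x v p : 'rV[R]_n) (H : 'M[R]_n).

(** The second-order polynomial with value c, gradient p and, for symmetric H, Hessian H at x0; it
    is C^2 everywhere, hence admissible as a test function. *)
Definition quad (c : R) p H x0 x : R :=
  c + dot p (x - x0) + 2^-1 * dot ((x - x0) *m H) (x - x0).

Lemma dot_mulmx x y H : dot (x *m H) y = dot x (y *m H^T).
Proof.
have dotE a b : dot a b = (a *m b^T) 0 0.
  by rewrite mxE; apply: eq_bigr => i _; rewrite mxE.
by rewrite !dotE trmx_mul trmxK mulmxA.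
Qed.

Lemma dot_delta x i : dot x (delta_mx 0 i) = x 0 i.
Proof.
rewrite /dot (bigD1 i)//= big1 ?addr0 => [|j ji]; first by rewrite mxE !eqxx mulr1.
by rewrite mxE (negbTE ji) andbF mulr0.
Qed.

Lemma is_derive_quad c p H x0 x i : H^T = H ->
  is_derive x (delta_mx 0 i) (quad c p H x0) (p 0 i + ((x - x0) *m H) 0 i).
Proof.
move=> HT; apply: (@is_derive_quadratic _ _ _ _ _ _ (2^-1 * dot (delta_mx 0 i *m H) (delta_mx 0 i))) => h.
rewrite /quad; set d := x - x0.
have -> : h *: delta_mx 0 i + x - x0 = d + h *: delta_mx 0 i by rewrite /d -addrA addrC.
move: d => d; rewrite dotDr dotZr dot_delta mulmxDl dotDl !dotDr -scalemxAl !(dotZl, dotZr).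
have -> : dot (delta_mx 0 i *m H) d = (d *m H) 0 i.
  by rewrite dot_mulmx HT dotC dot_delta.
by rewrite !dot_delta; field.
Qed.

Lemma partial_quad c p H x0 i : H^T = H ->
  partial i (quad c p H x0) = fun x => p 0 i + ((x - x0) *m H) 0 i.
Proof.
by move=> HT; apply/funext => x; have [] := is_derive_quad c p x0 x i HT.
Qed.

Lemma is_derive_affine a H x0 x i j :
  is_derive x (delta_mx 0 i) (fun x => a + ((x - x0) *m H) 0 j) (H i j).
Proof.
apply: (@is_derive_quadratic _ _ _ _ _ _ 0) => h.
rewrite (_ : _ - x0 = h *: delta_mx 0 i + (x - x0)); last by rewrite addrA.
rewrite mulmxDl -scalemxAl -rowE !mxE; ring.
Qed.

Lemma coordB_continuous x0 i : continuous (fun x => (x - x0) 0 i).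
Proof.
rewrite (_ : (fun _ => _) = (fun x => x 0 i - x0 0 i)); last first.
  by apply/funext => x; rewrite !mxE.
move=> x; apply: (@cvgB _ _ _ (nbhs x) _ (fun x => x 0 i) (fun=> x0 0 i)).
  exact: coord_continuous.
exact: cvg_cst.
Qed.

Lemma affine_continuous a H x0 j : continuous (fun x => a + ((x - x0) *m H) 0 j).
Proof.
rewrite (_ : (fun _ => _) = fun x => a + \sum_k (x - x0) 0 k * H k j); last first.
  by apply/funext => x; rewrite mxE.
have cs : continuous (fun x => \sum_k (x - x0) 0 k * H k j).
  apply: continuous_big => [|i _]; first exact: add_continuous.
  move=> y; apply: (@cvgM _ _ (nbhs y) _ (fun x => (x - x0) 0 i) (fun=> H i j)).
    exact: coordB_continuous.
  exact: cvg_cst.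
move=> x; apply: (@cvgD _ _ _ (nbhs x) _ (fun=> a)); first exact: cvg_cst.
exact: cs.
Qed.

Lemma quad_continuous c p H x0 : continuous (quad c p H x0).
Proof.
have c1 : continuous (fun x => dot p (x - x0)).
  apply: continuous_big => [|i _]; first exact: add_continuous.
  move=> y; apply: (@cvgM _ _ (nbhs y) _ (fun=> p 0 i) (fun x => (x - x0) 0 i)).
    exact: cvg_cst.
  exact: coordB_continuous.
have c2 : continuous (fun x => dot ((x - x0) *m H) (x - x0)).
  apply: continuous_big => [|i _]; first exact: add_continuous.
  move=> y; apply: (@cvgM _ _ (nbhs y) _ (fun x => ((x - x0) *m H) 0 i) (fun x => (x - x0) 0 i)).
    have := @affine_continuous 0 H x0 i y.
    by rewrite /continuous_at add0r; under eq_fun do rewrite add0r.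
  exact: coordB_continuous.
move=> x; apply: (@cvgD _ _ _ (nbhs x) _ (fun x => c + dot p (x - x0))).
  apply: (@cvgD _ _ _ (nbhs x) _ (fun=> c)); first exact: cvg_cst.
  exact: c1.
apply: (@cvgM _ _ (nbhs x) _ (fun=> 2^-1)); first exact: cvg_cst.
exact: c2.
Qed.

Lemma C2_quad Omega c p H x0 : H^T = H -> C2_on Omega (quad c p H x0).
Proof.
move=> HT x _; split.
- exact: quad_continuous.
- move=> i; split; first by have [] := is_derive_quad c p x0 x i HT.
  by rewrite partial_quad//; exact: affine_continuous.
- move=> i j; rewrite (partial_quad c p x0 j HT).
  split; first by have [] := @is_derive_affine (p 0 j) H x0 x i j.
  rewrite (_ : partial i _ = cst (H i j)); first exact: cst_continuous.
  by apply/funext => y; have [] := @is_derive_affine (p 0 j) H x0 y i j.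
Qed.

Lemma A_mx_quad c p H x0 : (2 < n)%N -> 0 < c -> H^T = H ->
  A_mx (quad c p H x0) x0 =
    (2 / (n%:R - 2) ^+ 2 * c `^ (- (2 * n%:R / (n%:R - 2)))) *:
      (- ((n%:R - 2) * c) *: H + n%:R *: (p^T *m p) - (dot p p)%:M).
Proof.
move=> n2 c0 HT; set N : R := n%:R; have N2 : N - 2 != 0.
  by rewrite subr_eq0 eqr_nat gtn_eqF.
have qx0 : quad c p H x0 x0 = c.
  by rewrite /quad subrr dotC mul0mx /dot !big1 ?mulr0 ?addr0// => i _; rewrite mxE mul0r.
have px0 i : partial i (quad c p H x0) x0 = p 0 i.
  by rewrite partial_quad// subrr mul0mx mxE addr0.
have pp i j : partial i (partial j (quad c p H x0)) x0 = H i j.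
  by rewrite partial_quad//; have [] := @is_derive_affine (p 0 j) H x0 x0 i j.
apply/matrixP => i j; rewrite /A_mx !mxE big_ord1 !mxE qx0 !px0 pp.
(* Splitting off one power of c gives all three terms the same positive factor. *)
rewrite (_ : - ((N + 2) / (N - 2)) = 1 + - (2 * N / (N - 2))); last by field.
rewrite powRD ?(gt_eqF c0) ?implybT// powRr1 ?ltW//.
rewrite (_ : \sum_(k < n) _ = dot p p); last first.
  by apply: eq_bigr => k _; rewrite px0 expr2.
rewrite -[dot p p *+ _]mulr_natr (_ : ord0 = 0)// -/N.
by set P := c `^ _; field.
Qed.

End QuadraticTest.

Section Touch.
Context {R : realType} {n : nat}.
Variables (Gamma Omega : set 'rV[R]_n) (u : 'rV[R]_n -> R).
Hypotheses (n2 : (2 < n)%N) (hu : viscosity_sol Gamma Omega u).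

Lemma viscosity_quad x0 p (H : 'M[R]_n) : Omega x0 -> 0 < u x0 -> H^T = H ->
  (\forall x \near x0, quad (u x0) p H x0 x <= u x) ->
  eigenvalues_in ((2 / (n%:R - 2) ^+ 2 * u x0 `^ (- (2 * n%:R / (n%:R - 2)))) *:
      (- ((n%:R - 2) * u x0) *: H + n%:R *: (p^T *m p) - (dot p p)%:M))
    (closure Gamma).
Proof.
move=> Ox0 ux0 HT near_le; rewrite -(A_mx_quad p x0 n2 ux0 HT).
apply: hu => //.
- exact: C2_quad.
- rewrite /quad subrr dotC mul0mx /dot !big1 ?mulr0 ?addr0 ?subrr// => i _; by rewrite mxE mul0r.
- by apply: filterS near_le => x; rewrite subr_ge0.
Qed.

End Touch.

(** * The closure of the cone: sums, trace, and the constraint given by mu *)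

Section Cone.
Context {R : realType} {n : nat}.
Variables (Gamma : set 'rV[R]_n).
Hypotheses (hG : open_convex_symmetric_cone Gamma)
  (hpos : [set lam : 'rV[R]_n | forall i, 0 < lam 0 i] `<=` Gamma)
  (htr : Gamma `<=` [set lam : 'rV[R]_n | 0 < \sum_(i < n) lam 0 i]).

(** The sum is twice the midpoint, so convexity and scaling suffice. *)
Lemma cone_add x y : Gamma x -> Gamma y -> Gamma (x + y).
Proof.
case: hG => _ cG sG _ Gx Gy.
have h0 : 0 <= (2^-1 : R) by lra.
have h1 : (2^-1 : R) <= 1 by lra.
have := cG x y (Itv01 h0 h1); rewrite !inE => /(_ Gx Gy) Gxy.
rewrite (_ : x + y = 2 *: conv (Itv01 h0 h1) (x : convex_lmodType 'rV[R]_n) y).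
  by apply: sG Gxy; rewrite ltr0n.
rewrite [conv _ _ _](_ : _ = 2^-1 *: x + (1 - 2^-1) *: y)//.
by apply/rowP => i; rewrite !mxE; field.
Qed.

Lemma near_cone_shift x y : Gamma y -> \forall z \near x, Gamma (y + x - z).
Proof.
case: hG => oG _ _ _ Gy.
have /nbhs_enorm [e e0 eG] := open_nbhs_nbhs (conj oG Gy).
apply/nbhs_enorm; exists e => // z ze; apply: eG.
have -> : y + x - z - y = x - z by rewrite addrAC [y + x]addrC addrK.
by rewrite enorm_distC.
Qed.

(** Pick z in [Gamma] so near x that y + x - z still lies in the open set [Gamma]; the sum then
    splits into these two members. *)
Lemma closure_cone_add x y : closure Gamma x -> Gamma y -> Gamma (x + y).
Proof.
move=> clx Gy; have [z [Gz Gyz]] := clx _ (near_cone_shift x Gy).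
have -> : x + y = z + (y + x - z) by rewrite addrC [RHS]addrC subrK.
exact: cone_add.
Qed.

Lemma closure_coneZ t x : 0 < t -> closure Gamma x -> closure Gamma (t *: x).
Proof.
case: hG => _ _ sG _ t0 clx B.
have t1 : 0 < t^-1 by rewrite invr_gt0.
move=> /nbhs_enorm[e e0 eB].
have et : 0 < t^-1 * e by rewrite mulr_gt0.
have [y [Gy ye]] := clx _ (near_enorm x et).
exists (t *: y); split; first exact: sG.
apply: eB; rewrite -scalerBr enormZ gtr0_norm//.
by rewrite -(@ltr_pM2l _ t^-1)// mulrA mulVf ?mul1r// gt_eqF.
Qed.

Lemma closure_cone_perm (s : 'S_n) x : closure Gamma x -> closure Gamma (col_perm s x).
Proof.
case: hG => _ _ _ pG clx B /nbhs_enorm[e e0 eB].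
have [y [Gy ye]] := clx _ (near_enorm x e0).
exists (col_perm s y); split; first exact: pG.
apply: eB; suff -> : enorm (col_perm s y - col_perm s x) = enorm (y - x) by [].
rewrite /enorm [in RHS](reindex_inj (@perm_inj _ s)); congr Num.sqrt.
by apply: eq_bigr => i _; rewrite !mxE.
Qed.

Lemma closure_cone_sum x : closure Gamma x -> 0 <= \sum_(i < n) x 0 i.
Proof.
have -> : \sum_(i < n) x 0 i = dot (const_mx 1) x.
  by apply: eq_bigr => i _; rewrite mxE mul1r.
move=> clx; rewrite leNgt; apply/negP => x0.
(* The added 1 keeps c positive. Cauchy-Schwarz against the vector of ones transfers a negative sum
   from x to nearby points of [Gamma]. *)
pose c : R := enorm (const_mx 1 : 'rV[R]_n) + 1.
have c0 : 0 < c by rewrite ltr_pwDr ?enorm_ge0.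
have e0 : 0 < - dot (const_mx 1) x / c by rewrite divr_gt0 ?oppr_gt0.
have [y [/htr /= Gy ye]] := clx _ (near_enorm x e0).
move: Gy; rewrite (_ : \sum_i _ = dot (const_mx 1) y); last first.
  by apply: eq_bigr => i _; rewrite mxE mul1r.
rewrite -(subrK x y) dotDr; apply/negP; rewrite -leNgt -lerBrDr sub0r.
apply: le_trans (dot_le_enorm _ _) _.
apply: (@le_trans _ _ (c * enorm (y - x))).
  by rewrite ler_wpM2r ?enorm_ge0// lerDl.
by rewrite mulrC -ler_pdivlMr// ltW.
Qed.

Variables (mu : R).
Hypotheses (hn : (0 < n)%N) (hmu : is_mu_plus Gamma mu).

(** If b + mu a < 0, a rescaled permutation of x plus a positive multiple of (1, ..., 1) equals
    (-mu, 1, ..., 1), which would then lie in the open set [Gamma] instead of on its boundary. *)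
Lemma closure_cone_mu (x : 'rV[R]_n) i0 a b : closure Gamma x ->
  (forall i, x 0 i = if i == i0 then b else a) -> 0 < a -> 0 <= mu -> 0 <= b + mu * a.
Proof.
move=> clx xE a0 mu0; rewrite leNgt; apply/negP => ba.
pose j0 := Ordinal hn.
have ab : 0 < a - b by nra.
(* This scale t and the shift r below solve t b + r = - mu and t a + r = 1. *)
have t0 : 0 < (1 + mu) / (a - b) by rewrite divr_gt0//; lra.
have clx' := closure_coneZ t0 (closure_cone_perm (s := tperm i0 j0) clx).
pose r := - (b + mu * a) / (a - b).
have r0 : 0 < r by rewrite divr_gt0// oppr_gt0.
have Gr : Gamma (const_mx r) by apply: hpos => i; rewrite mxE.
have := closure_cone_add clx' Gr.
case: hmu => _ [_]; rewrite /interior => nG Gx; apply: nG.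
case: hG => oG _ _ _.
rewrite (_ : (\row_j _) = (1 + mu) / (a - b) *: col_perm (tperm i0 j0) x + const_mx r).
  exact: open_nbhs_nbhs (conj oG Gx).
have abn : a - b != 0 by rewrite gt_eqF.
apply/rowP => j; rewrite !mxE xE /r.
have -> : (tperm i0 j0 j == i0) = (j == 0%N :> nat).
  by rewrite -(inj_eq (@perm_inj _ (tperm i0 j0))) tpermK tpermL.
by case: ifP => _; field.
Qed.

(** The trace and the sum of the roots are read off the same coefficient of the characteristic
    polynomial. *)
Lemma eigenvalues_trace (A : 'M[R]_n) : eigenvalues_in A (closure Gamma) -> 0 <= \tr A.
Proof.
case=> lam [cA /closure_cone_sum].
suff -> : \tr A = \sum_(i < n) lam 0 i by [].
apply: oppr_inj; rewrite -char_poly_trace// cA.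
have := @coefPn_prod_XsubC R [seq lam 0 i | i <- enum 'I_n].
rewrite size_map size_enum_ord -lt0n => /(_ hn).
by rewrite big_map big_enum big_map big_enum.
Qed.

End Cone.

(** * Spectra of rank-one perturbations of scalar matrices *)

Section Radial.
Context {R : realType} {n : nat}.
Variables (Gamma : set 'rV[R]_n) (mu : R).
Hypotheses (hG : open_convex_symmetric_cone Gamma)
  (hpos : [set lam : 'rV[R]_n | forall i, 0 < lam 0 i] `<=` Gamma)
  (hn : (0 < n)%N) (hmu : is_mu_plus Gamma mu) (mu0 : 0 <= mu).

Lemma mulmx_tr_dot (v z : 'rV[R]_n) : v *m z^T = (dot v z)%:M.
Proof.
apply/rowP => i; rewrite ord1 !mxE eqxx mulr1n.
by apply: eq_bigr => j _; rewrite mxE.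
Qed.

Lemma mxtrace_rank1 (z : 'rV[R]_n) : \tr (z^T *m z) = dot z z.
Proof. by rewrite mxtrace_mulC mulmx_tr_dot mxtrace_scalar mulr1n. Qed.

(** An eigenvector v satisfies (l - a) v = b (dot v z) z: either v is orthogonal to z and l = a, or
    pairing with z gives the other value. *)
Lemma eigenvalue_rank1 (a b l : R) (z : 'rV[R]_n) :
  eigenvalue (a%:M + b *: (z^T *m z)) l -> l = a \/ l = a + b * dot z z.
Proof.
move=> /eigenvalueP[v].
rewrite mulmxDr mul_mx_scalar -scalemxAr mulmxA mulmx_tr_dot mul_scalar_mx scalerA.
move=> vE v0; have : (l - a) *: v = (b * dot v z) *: z.
  by rewrite scalerBl -vE addrAC subrr add0r.
have [->|t0] := eqVneq (dot v z) 0.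
  by rewrite mulr0 scale0r => /eqP; rewrite scaler_eq0 (negbTE v0) orbF subr_eq0 => /eqP; left.
move=> /(congr1 (dot^~ z)); rewrite !dotZl mulrAC => /(mulIf t0) <-; right; ring.
Qed.

(** Unless b |z|^2 = 0, the list of eigenvalues is a permutation of (a + b |z|^2, a, ..., a), to
    which [closure_cone_mu] applies. *)
Lemma radial_eigenvalues (a b : R) (z : 'rV[R]_n) : 0 < a ->
  eigenvalues_in (a%:M + b *: (z^T *m z)) (closure Gamma) ->
  0 <= a + b * dot z z + mu * a.
Proof.
move=> a0; have [->|bz0] := eqVneq (b * dot z z) 0.
  by move=> _; rewrite addr0 addr_ge0 ?mulr_ge0// ltW.
set A := (a%:M + _); case=> lam [cA clam].
have lamE i : lam 0 i = a \/ lam 0 i = a + b * dot z z.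
  apply: eigenvalue_rank1; rewrite eigenvalue_root_char -/A cA.
  by rewrite /root horner_prod (bigD1 i)//= hornerXsubC subrr mul0r.
have trA : \tr A = \sum_(i < n) lam 0 i.
  apply: oppr_inj; rewrite -char_poly_trace// cA.
  have := @coefPn_prod_XsubC R [seq lam 0 i | i <- enum 'I_n].
  rewrite size_map size_enum_ord -lt0n => /(_ hn).
  by rewrite big_map big_enum big_map big_enum.
have lamb i : lam 0 i = a + (b * dot z z) *+ (lam 0 i != a).
  by case: eqP => [->|/=]; rewrite ?addr0//; case: (lamE i).
(* The trace determines how many eigenvalues differ from a. *)
have : #|[set i | lam 0 i != a]%SET| = 1%N.
  apply/eqP; rewrite -(eqr_nat R) -(inj_eq (mulfI bz0)) mulr1 mulr_natr; apply/eqP.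
  move: trA; rewrite mxtraceD mxtrace_scalar mxtraceZ mxtrace_rank1.
  under eq_bigr do rewrite lamb.
  rewrite big_split/= sumr_const card_ord => /addrI.
  move=> tE; rewrite [RHS]tE -sum1_card -sumrMnr [LHS]big_mkcond/=.
  by apply: eq_bigr => i _; rewrite inE; case: eqP.
move=> /eqP/cards1P[i0 S1].
apply: (@closure_cone_mu R n Gamma hG hpos mu hn hmu lam i0 a (a + b * dot z z)) => // i.
move/finset.setP: S1 => /(_ i); rewrite !inE => <-.
by case: eqP => [->//|]; case: (lamE i).
Qed.

End Radial.

(** * Second-order expansions from below *)

Lemma taylor2_lower (R : realType) (G G1 : R -> R) (s0 g2 eta : R) : 0 < eta ->
  (\forall s \near s0, is_derive (s : R) (1 : R) G (G1 s)) -> is_derive (s0 : R) (1 : R) G1 g2 ->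
  \forall s \near s0,
    G s0 + G1 s0 * (s - s0) + (g2 / 2 - eta) * (s - s0) ^+ 2 <= G s.
Proof.
move=> eta0 dG [dG1 g2E].
have : h^-1 *: (G1 (h *: 1 + s0) - G1 s0) @[h --> (0 : R)^'] --> g2.
  by rewrite -g2E; exact: dG1.
move=> /cvgrPdist_le /(_ _ eta0); rewrite near_withinE /= => /nbhs_ballP[d1 /= d10 G1b].
move/nbhs_ballP : dG => [d2 /= d20 dG].
apply/nbhs_ballP; exists (Num.min d1 d2) => /=; first by rewrite lt_min d10 d20.
move=> s; rewrite /ball/= lt_min => /andP[sd1 sd2].
(* The difference quotient of G1 at s0 is at least g2 - eta, so the derivative of the difference [D]
   has the sign of c - s0, and the mean value theorem puts the minimum of [D] at s0. *)
have slope c : `|s0 - c| < d1 -> 0 <= (c - s0) * (G1 c - G1 s0 - (g2 - 2 * eta) * (c - s0)).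
  move=> cd1; have [->|cs0] := eqVneq c s0; first by rewrite subrr mul0r.
  have cs : c - s0 != 0 by rewrite subr_eq0.
  have := G1b (c - s0); rewrite /ball/= sub0r normrN distrC => /(_ cd1 cs).
  rewrite /GRing.scale/= mulr1 subrK => /ler_normlP[_].
  have c2 : 0 < (c - s0) ^+ 2 by rewrite exprn_even_gt0.
  rewrite -(ler_pM2l c2) => h.
  have e : (c - s0) ^+ 2 * ((c - s0)^-1 * (G1 c - G1 s0)) = (c - s0) * (G1 c - G1 s0) by field.
  by move: h; rewrite mulrBr e; nra.
pose q t := G1 s0 * (t - s0) + (g2 / 2 - eta) * (t - s0) ^+ 2.
pose D t := G t - q t.
have dD c : `|s0 - c| < d2 -> is_derive (c : R) (1 : R) D (G1 c - G1 s0 - (g2 - 2 * eta) * (c - s0)).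
  move=> cd2; have dq : is_derive (c : R) (1 : R) q (G1 s0 + (g2 - 2 * eta) * (c - s0)).
    have := @is_derive_quadratic R R (q : R -> R) (c : R) (1 : R) (G1 s0 + (g2 - 2 * eta) * (c - s0)) (g2 / 2 - eta).
    apply => h.
    by rewrite /q /GRing.scale/=; field.
  by rewrite -addrA -opprD; exact: (is_deriveB (dG c cd2) dq).
have DE : D s0 = G s0 by rewrite /D /q subrr; ring.
suff : D s0 <= D s by rewrite DE /D /q; lra.
have cont a b : (forall c, c \in `[a, b] -> `|s0 - c| < d2) -> {within `[a, b], continuous D}.
  move=> ab; apply: derivable_within_continuous => c cab.
  by have [] := dD c (ab c cab).
have [ss0|s0s|->//] := ltgtP s s0.
- have inb c : c \in `[s, s0] -> `|s0 - c| < Num.min d1 d2.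
    rewrite in_itv/= => /andP[sc cs]; rewrite lt_min.
    have h : `|s0 - c| <= `|s0 - s| by rewrite !ger0_norm ?subr_ge0 ?(ltW ss0)// lerB.
    by rewrite !(le_lt_trans h).
  have inb1 c : c \in `[s, s0] -> `|s0 - c| < d1 by move=> /inb; rewrite lt_min => /andP[].
  have inb2 c : c \in `[s, s0] -> `|s0 - c| < d2 by move=> /inb; rewrite lt_min => /andP[].
  have dDi c : c \in `]s, s0[ -> is_derive (c : R) (1 : R) D (G1 c - G1 s0 - (g2 - 2 * eta) * (c - s0)).
    by move=> cs; apply: dD; apply: inb2; exact: subset_itv_oo_cc.
  have [c cs] := MVT ss0 dDi (cont _ _ inb2).
  move/eqP; rewrite subr_eq => /eqP ->; rewrite gerDr.
  have := slope c (inb1 c (subset_itv_oo_cc cs)).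
  move: cs; rewrite in_itv/= => /andP[sc cs]; rewrite nmulr_rge0 ?subr_lt0// => h.
  by rewrite mulr_le0_ge0// subr_ge0 ltW.
- have inb c : c \in `[s0, s] -> `|s0 - c| < Num.min d1 d2.
    rewrite in_itv/= => /andP[sc cs]; rewrite lt_min.
    have h : `|s0 - c| <= `|s0 - s|.
      by rewrite distrC (distrC _ s) !ger0_norm ?subr_ge0 ?(ltW s0s)// lerB.
    by rewrite !(le_lt_trans h).
  have inb1 c : c \in `[s0, s] -> `|s0 - c| < d1 by move=> /inb; rewrite lt_min => /andP[].
  have inb2 c : c \in `[s0, s] -> `|s0 - c| < d2 by move=> /inb; rewrite lt_min => /andP[].
  have dDi c : c \in `]s0, s[ -> is_derive (c : R) (1 : R) D (G1 c - G1 s0 - (g2 - 2 * eta) * (c - s0)).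
    by move=> cs; apply: dD; apply: inb2; exact: subset_itv_oo_cc.
  have [c cs] := MVT s0s dDi (cont _ _ inb2).
  rewrite -subr_ge0 => ->.
  have := slope c (inb1 c (subset_itv_oo_cc cs)).
  move: cs; rewrite in_itv/= => /andP[sc cs]; rewrite pmulr_rge0 ?subr_gt0// => h.
  by rewrite mulr_ge0// subr_ge0 ltW.
Qed.

Section Jet.
Context {R : realType} {n : nat}.
Implicit Types (x y p : 'rV[R]_n) (H : 'M[R]_n) (phi : 'rV[R]_n -> R).

(* Test functions have to be C^2 on the whole of Omega, whereas the barriers are
   singular at their centers; so barriers only enter through their second-order
   expansions from below, which are realized by quadratic polynomials. *)
Definition lower_jet phi x0 p H := forall eta : R, 0 < eta -> \forall x \near x0,
  phi x0 + dot p (x - x0) + 2^-1 * dot ((x - x0) *m H) (x - x0)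
    - eta * dot (x - x0) (x - x0) <= phi x.

Lemma lower_jet_cst c x0 : lower_jet (fun=> c) x0 0 0.
Proof.
move=> eta eta0; apply/nbhs_enorm; exists 1 => // x _.
rewrite mulmx0 !(dotC 0) !dot0r mulr0 !addr0.
by rewrite lerBlDr lerDl mulr_ge0 ?dot_ge0 ?ltW.
Qed.

Lemma lower_jetD phi psi x0 p q H K : lower_jet phi x0 p H -> lower_jet psi x0 q K ->
  lower_jet (fun x => phi x + psi x) x0 (p + q) (H + K).
Proof.
move=> jp jq eta eta0; have eta2 : 0 < eta / 2 by rewrite divr_gt0.
near=> x.
have h1 : phi x0 + dot p (x - x0) + 2^-1 * dot ((x - x0) *m H) (x - x0)
    - eta / 2 * dot (x - x0) (x - x0) <= phi x by near: x; exact: jp.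
have h2 : psi x0 + dot q (x - x0) + 2^-1 * dot ((x - x0) *m K) (x - x0)
    - eta / 2 * dot (x - x0) (x - x0) <= psi x by near: x; exact: jq.
move: (x - x0) h1 h2 => d h1 h2; rewrite mulmxDr !dotDl; lra.
Unshelve. all: by end_near. Qed.

Lemma dot_rank1 x z : dot (x *m (z^T *m z)) x = dot z x ^+ 2.
Proof. by rewrite mulmxA mulmx_tr_dot mul_scalar_mx dotZl (dotC x) expr2. Qed.

Lemma dot_abs x y : `|dot x y| <= enorm x * enorm y.
Proof. by rewrite ler_norml dot_le_enorm lerNl -dotNr -(enormN y) dot_le_enorm. Qed.

(** With d = x - x0 the increment of |x - y|^2 is 2 dot z d + |d|^2. Inserted in the lower expansion
    of G, it leaves beyond the jet only terms absorbed by eta |d|^2. *)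
Lemma lower_jet_radial (G G1 : R -> R) (g2 : R) x0 y :
  (\forall s \near (dot (x0 - y) (x0 - y)), is_derive (s : R) (1 : R) G (G1 s)) ->
  is_derive (dot (x0 - y) (x0 - y) : R) (1 : R) G1 g2 ->
  lower_jet (fun x => G (dot (x - y) (x - y))) x0
    ((2 * G1 (dot (x0 - y) (x0 - y))) *: (x0 - y))
    ((4 * g2) *: ((x0 - y)^T *m (x0 - y)) + (2 * G1 (dot (x0 - y) (x0 - y)))%:M).
Proof.
move=> dG dG1 eta eta0; set z := x0 - y; set s0 := dot z z in dG dG1 *.
have Z0 := enorm_ge0 z; set Z := enorm z in Z0.
(* Since |2 q + m^2| <= (2 Z + 1) m for m <= 1, this eta1 costs at most (eta / 2) m^2. *)
pose eta1 := eta / (2 * (2 * Z + 1) ^+ 2).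
have eta10 : 0 < eta1 by rewrite divr_gt0// mulr_gt0// exprn_gt0//; lra.
have /nbhs_ballP[d /= d0 tay] := taylor2_lower eta10 dG dG1.
(* The three bounds give m <= 1, keep |x - y|^2 in the range of the expansion, and let (eta / 2) m^2
   absorb the cubic and quartic terms with factor g2. *)
pose r := Num.min 1 (Num.min (d / (2 * Z + 1)) (eta / (`|g2| * (4 * Z + 1) + 1))).
have g20 : 0 <= `|g2| by [].
have r0 : 0 < r.
  by rewrite !lt_min ltr01 !divr_gt0//= ltr_wpDl// ?mulr_ge0//; lra.
apply: filterS (near_enorm x0 r0) => x; set dd := x - x0; set m := enorm dd.
rewrite !lt_min => /and3P[m1 md me].
have m0 : 0 <= m := enorm_ge0 dd.
have ddE : dot dd dd = m ^+ 2 by rewrite enorm_sqr.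
have sE : dot (x - y) (x - y) - s0 = 2 * dot z dd + m ^+ 2.
  have -> : x - y = z + dd by rewrite /z /dd [RHS]addrC addrA subrK.
  by rewrite dot_sqrD ddE /s0; ring.
have := dot_abs z dd; rewrite -/m -/Z; set q := dot z dd in sE * => qle.
have /ler_normlP[q1 q2] := qle.
have ballx : `|s0 - dot (x - y) (x - y)| < d.
  rewrite distrC sE; apply: (@le_lt_trans _ _ (m * (2 * Z + 1))).
    by apply/ler_normlP; split; nra.
  by rewrite -ltr_pdivlMr//; lra.
have := tay _ ballx; rewrite sE => tayx.
apply: le_trans tayx.
rewrite mulmxDr -scalemxAr mul_mx_scalar dotDl !dotZl dot_rank1 ddE -/q.
have key : (`|g2| * (4 * Z + 1)) * m <= eta.
  move: me; rewrite ltr_pdivlMr; last by rewrite ltr_wpDl// mulr_ge0//; lra.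
  by move=> me; nra.
have b1 : (2 * q + m ^+ 2) ^+ 2 <= (2 * Z + 1) ^+ 2 * m ^+ 2.
  have : `|2 * q + m ^+ 2| <= (2 * Z + 1) * m by apply/ler_normlP; split; nra.
  rewrite -exprMn => h; rewrite -[X in X <= _]real_normK ?num_real//.
  by rewrite ler_pXn2r ?nnegrE//; nra.
have b2 : eta1 * (2 * q + m ^+ 2) ^+ 2 <= eta / 2 * m ^+ 2.
  apply: (@le_trans _ _ (eta1 * ((2 * Z + 1) ^+ 2 * m ^+ 2))).
    by rewrite ler_pM2l.
  rewrite /eta1 le_eqVlt; apply/orP; left; apply/eqP; field.
  by apply: lt0r_neq0; lra.
have b3 : - (eta / 2 * m ^+ 2) <= g2 / 2 * (4 * q * m ^+ 2 + m ^+ 4).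
  have h : `|4 * q * m ^+ 2 + m ^+ 4| <= (4 * Z + 1) * m * m ^+ 2.
    have -> : 4 * q * m ^+ 2 + m ^+ 4 = (4 * q + m ^+ 2) * m ^+ 2 by ring.
    rewrite normrM (ger0_norm (sqr_ge0 m)) ler_wpM2r ?sqr_ge0//.
    by apply/ler_normlP; split; nra.
  rewrite lerNl; apply: le_trans (ler_norm _) _.
  rewrite normrN normrM (normrM g2) (@ger0_norm _ 2^-1) ?invr_ge0//.
  apply: (@le_trans _ _ (`|g2| / 2 * ((4 * Z + 1) * m * m ^+ 2))).
    by rewrite ler_wpM2l// divr_ge0.
  have := sqr_ge0 m; nra.
nra.
Qed.

End Jet.

Lemma rank1Z (R : realType) (n : nat) (c : R) (z : 'rV[R]_n) :
  (c *: z)^T *m (c *: z) = c ^+ 2 *: (z^T *m z).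
Proof.
have -> : (c *: z)^T = c *: z^T by apply/matrixP => i j; rewrite !mxE.
by rewrite -scalemxAl -scalemxAr scalerA.
Qed.

(** * Necessary conditions where a barrier touches [u] from below *)

Section TouchConclusions.
Context {R : realType} {n : nat}.
Variables (Gamma Omega : set 'rV[R]_n) (mu : R) (u : 'rV[R]_n -> R).
Hypotheses (n2 : (2 < n)%N)
  (hG : open_convex_symmetric_cone Gamma)
  (hpos : [set lam : 'rV[R]_n | forall i, 0 < lam 0 i] `<=` Gamma)
  (htr : Gamma `<=` [set lam : 'rV[R]_n | 0 < \sum_(i < n) lam 0 i])
  (hmu : is_mu_plus Gamma mu) (mu0 : 0 <= mu) (mu1 : mu < 1)
  (hu : viscosity_sol Gamma Omega u).

Let N : R := n%:R.

Lemma natr_gt2 : 0 < N - 2.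
Proof. by rewrite subr_gt0 ltr_nat. Qed.

(** Subtracting eta |x - x0|^2 turns the expansion into a quadratic polynomial that touches u from
    below; this is the shift of H by 2 eta. *)
Lemma viscosity_jet (phi : 'rV[R]_n -> R) x0 p (H : 'M[R]_n) (eta : R) :
  Omega x0 -> 0 < u x0 -> H^T = H -> lower_jet phi x0 p H ->
  (\forall x \near x0, phi x - phi x0 <= u x - u x0) -> 0 < eta ->
  eigenvalues_in ((2 / (N - 2) ^+ 2 * u x0 `^ (- (2 * N / (N - 2)))) *:
      (- ((N - 2) * u x0) *: (H - (2 * eta)%:M) + N *: (p^T *m p) - (dot p p)%:M))
    (closure Gamma).
Proof.
move=> Ox0 ux0 HT jet near_le eta0; apply: (viscosity_quad n2 hu Ox0 ux0).
  by rewrite linearB/= tr_scalar_mx HT.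
near=> x.
have h1 : phi x - phi x0 <= u x - u x0 by near: x.
have h2 : phi x0 + dot p (x - x0) + 2^-1 * dot ((x - x0) *m H) (x - x0)
    - eta * dot (x - x0) (x - x0) <= phi x by near: x; exact: jet.
rewrite /quad mulmxBr mul_mx_scalar; move: (x - x0) h2 => d h2.
rewrite dotDl -scaleN1r !dotZl; lra.
Unshelve. all: by end_near. Qed.

Let kappa0 x0 : 0 < u x0 -> 0 < 2 / (N - 2) ^+ 2 * u x0 `^ (- (2 * N / (N - 2))).
Proof.
by move=> ux0; rewrite mulr_gt0 ?powR_gt0// divr_gt0// exprn_gt0// natr_gt2.
Qed.

(** The gradient terms of A have traces N |p|^2 and - N |p|^2 and cancel, so u is superharmonic in
    the viscosity sense. *)
Lemma touch_trace (phi : 'rV[R]_n -> R) x0 p (H : 'M[R]_n) :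
  Omega x0 -> 0 < u x0 -> H^T = H -> lower_jet phi x0 p H ->
  (\forall x \near x0, phi x - phi x0 <= u x - u x0) -> \tr H <= 0.
Proof.
move=> Ox0 ux0 HT jet near_le; rewrite leNgt; apply/negP => tH.
have N0 : 0 < N by rewrite ltr0n (leq_trans _ n2).
(* Then 2 eta N is half of \tr H, which leaves the trace of A negative. *)
have eta0 : 0 < \tr H / (4 * N) by rewrite divr_gt0// mulr_gt0.
have := viscosity_jet Ox0 ux0 HT jet near_le eta0.
have n0 : (0 < n)%N by rewrite (leq_trans _ n2).
move/(eigenvalues_trace htr n0).
rewrite linearZ/= pmulr_rge0; last exact: kappa0.
rewrite mxtraceD mxtraceD mxtraceZ mxtraceZ mxtraceD !raddfN/= !mxtrace_scalar mxtrace_rank1.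
have N2 := natr_gt2.
have -> : (2 * (\tr H / (4 * N))) *+ n = \tr H / 2.
  by rewrite -mulr_natr -/N; field; exact: lt0r_neq0.
have -> : dot p p *+ n = N * dot p p by rewrite -mulr_natr mulrC.
have : 0 < (N - 2) * u x0 by rewrite mulr_gt0.
move: (_ * u x0) => c c0; nra.
Qed.

(** Up to a positive factor and the slack eta, the matrix A of the radial test function is a I + b
    z^T z, where b is the factor in front of the last s; [radial_eigenvalues] then relates its
    eigenvalues a and a + b s. *)
Lemma touch_radial (G G1 : R -> R) (g2 : R) x0 y (z := x0 - y) (s := dot z z) :
  Omega x0 -> 0 < u x0 ->
  (\forall t \near s, is_derive (t : R) (1 : R) G (G1 t)) ->
  is_derive (s : R) (1 : R) G1 g2 ->
  (\forall x \near x0, G (dot (x - y) (x - y)) - G s <= u x - u x0) ->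
  let a := - (2 * (N - 2) * u x0 * G1 s) - 4 * G1 s ^+ 2 * s in
  0 < a -> 0 <= (1 + mu) * a + (- (4 * (N - 2) * u x0 * g2) + 4 * N * G1 s ^+ 2) * s.
Proof.
move=> Ox0 ux0 dG dG1 near_le /=; set a := (X in 0 < X) => a0.
set b := - (4 * (N - 2) * u x0 * g2) + 4 * N * G1 s ^+ 2.
rewrite leNgt; apply/negP => ab.
have jet := lower_jet_radial dG dG1; rewrite -/z -/s in jet.
have N2 := natr_gt2.
have c0 : 0 < 2 * (N - 2) * u x0 by rewrite !mulr_gt0.
(* With this eta the slack changes the negative quantity (1 + mu) a + b s to half of itself. *)
pose eta := - ((1 + mu) * a + b * s) / (2 * (2 * (N - 2) * u x0 * (1 + mu))).
have m1 : 0 < 1 + mu by rewrite ltr_wpDr.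
have eta0 : 0 < eta by rewrite divr_gt0 ?oppr_gt0// ?mulr_gt0.
have HT : ((4 * g2) *: (z^T *m z) + (2 * G1 s)%:M)^T = (4 * g2) *: (z^T *m z) + (2 * G1 s)%:M.
  by rewrite linearD/= linearZ/= trmx_mul trmxK tr_scalar_mx.
have := viscosity_jet Ox0 ux0 HT jet near_le eta0.
set k := 2 / _ * _; have k0 : 0 < k := kappa0 ux0.
set ae := a + 2 * (N - 2) * u x0 * eta.
have matE (Z : 'M[R]_n) : k *: (- ((N - 2) * u x0) *: ((4 * g2) *: Z + (2 * G1 s)%:M - (2 * eta)%:M)
    + N *: ((2 * G1 s) ^+ 2 *: Z) - ((2 * G1 s) ^+ 2 * s)%:M) = (k * ae)%:M + (k * b) *: Z.
  apply/matrixP => i j; rewrite /ae /a /b !mxE.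
  have E (c : R) : c *+ (i == j) = c * (if i == j then 1 else 0).
    by case: eqP; rewrite ?mulr1 ?mulr0.
  rewrite !E; move: (Z i j) (if i == j then _ else _) => t e.
  ring.
rewrite rank1Z dotZl dotZr mulrA -expr2 -/s matE.
have n0 : (0 < n)%N by rewrite (leq_trans _ n2).
move/(radial_eigenvalues hG hpos n0 hmu mu0).
have ae0 : 0 < ae by rewrite /ae addr_gt0// mulr_gt0.
rewrite mulr_gt0// -/s => /(_ isT).
have -> : k * ae + k * b * s + mu * (k * ae) = k * ((1 + mu) * ae + b * s) by ring.
rewrite pmulr_rge0//.
have -> : (1 + mu) * ae + b * s = ((1 + mu) * a + b * s) / 2.
  rewrite /ae /eta; field; apply/and3P; split; try by apply: lt0r_neq0; lra.
by rewrite pmulr_lge0// leNgt ab.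
Qed.

End TouchConclusions.

(** * Negative powers of cones as strict barriers *)

Lemma near_gt0 (R : realType) (s : R) : 0 < s -> \forall t \near s, 0 < t.
Proof.
move=> s0; apply/nbhs_ballP; exists s => //= t; rewrite /ball/= ltr_norml.
by move=> /andP[_]; rewrite ltrBlDr ltrDl.
Qed.

Lemma is_derive_powRZ (R : realType) (c e s : R) : 0 < s ->
  is_derive (s : R) (1 : R) (fun t => c * t `^ e) (c * (e * s `^ (e - 1))).
Proof.
move=> s0; have d := @is_derive1_powR R e s s0.
exact: is_deriveZ.
Qed.

Lemma is_derive_cone_profile (R : realType) (a b e k s : R) : 0 < a -> 0 < b -> 0 < s ->
  is_derive (s : R) (1 : R) (fun t => (a + b * t `^ e) `^ k)
    (k * (a + b * s `^ e) `^ (k - 1) * (b * (e * s `^ (e - 1)))).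
Proof.
move=> a0 b0 s0.
have dh : is_derive (s : R) (1 : R) (fun t => a + b * t `^ e) (b * (e * s `^ (e - 1))).
  have d1 := is_derive_powRZ b e s0.
  have := @is_deriveD R R R (cst a) (fun t => b * t `^ e) s 1 0 _ (is_derive_cst _ _ _) d1.
  by rewrite add0r.
have h0 : 0 < a + b * s `^ e by rewrite addr_gt0// mulr_gt0// powR_gt0.
have dp := @is_derive1_powR R k _ h0.
exact: (@is_derive1_comp R (@powR R ^~ k) (fun t => a + b * t `^ e) s _ _ dp dh).
Qed.

Lemma is_derive_cone_profile1 (R : realType) (a b e k s : R) : 0 < a -> 0 < b -> 0 < s ->
  is_derive (s : R) (1 : R)
    (fun t => k * (a + b * t `^ e) `^ (k - 1) * (b * (e * t `^ (e - 1))))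
    (k * (k - 1) * (a + b * s `^ e) `^ (k - 1 - 1) * (b * (e * s `^ (e - 1))) ^+ 2
     + k * (a + b * s `^ e) `^ (k - 1) * (b * e * ((e - 1) * s `^ (e - 1 - 1)))).
Proof.
move=> a0 b0 s0.
have d1 := is_derive_cone_profile e (k - 1) a0 b0 s0.
have d2 := is_derive_powRZ (b * e) (e - 1) s0.
have d3 := is_deriveZ k d1.
have d4 := is_deriveM d3 d2.
rewrite (_ : (fun t : R => _) = k *: (fun t : R => (a + b * t `^ e) `^ (k - 1))
    * (fun t : R => b * e * t `^ (e - 1))); last first.
  apply/funext => t.
  by transitivity (k * (a + b * t `^ e) `^ (k - 1) * (b * e * t `^ (e - 1))); [ring|].
apply: is_derive_eq; rewrite /GRing.scale/= [k *: _](_ : _ = k * (a + b * s `^ e) `^ (k - 1))//.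
ring.
Qed.

Lemma powR_succ (R : realType) (h r : R) : 0 < h -> h `^ r = h * h `^ (r - 1).
Proof.
move=> h0; rewrite -[X in X * _](powRr1 (ltW h0)) -powRD ?(gt_eqF h0) ?implybT//.
by rewrite addrC subrK.
Qed.

Lemma powR_cont (R : realType) (r s : R) : 0 < s -> {for s, continuous (fun t => t `^ r)}.
Proof.
move=> s0; apply: differentiable_continuous; apply/derivable1_diffP.
by have [] := @is_derive1_powR R r s s0.
Qed.

Section Barrier.
Context {R : realType} {n : nat}.
Variables (Gamma Omega : set 'rV[R]_n) (mu : R) (u : 'rV[R]_n -> R).
Hypotheses (n2 : (2 < n)%N)
  (hG : open_convex_symmetric_cone Gamma)
  (hpos : [set lam : 'rV[R]_n | forall i, 0 < lam 0 i] `<=` Gamma)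
  (htr : Gamma `<=` [set lam : 'rV[R]_n | 0 < \sum_(i < n) lam 0 i])
  (hmu : is_mu_plus Gamma mu) (mu0 : 0 <= mu) (mu1 : mu < 1)
  (hu : viscosity_sol Gamma Omega u).

Let N : R := n%:R.

(* The exponent 2 e = 1 - mu would give a multiple of (-mu, 1, ..., 1). *)
Lemma cone_barrier_strict (a b e k : R) x0 y (s := dot (x0 - y) (x0 - y)) :
  k * (1 - mu) = N - 2 -> Omega x0 -> 0 < u x0 -> y != x0 ->
  0 < a -> 0 < b -> 0 < e -> 2 * e < 1 - mu ->
  u x0 = (a + b * s `^ e) `^ (- k) ->
  ~ (\forall x \near x0, (a + b * dot (x - y) (x - y) `^ e) `^ (- k) <= u x).
Proof.
move=> kE Ox0 ux0 yx0 a0 b0 e0 e1 uE near_le.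
have s0 : 0 < s by rewrite /s -enorm_sqr exprn_gt0// enorm_gt0 subr_eq0 eq_sym.
have N2 : 0 < N - 2 by apply: natr_gt2.
have k0 : 0 < k by rewrite -(@pmulr_lgt0 _ (1 - mu)) ?kE// subr_gt0.
pose G t := (a + b * t `^ e) `^ (- k).
pose G1 t := - k * (a + b * t `^ e) `^ (- k - 1) * (b * (e * t `^ (e - 1))).
pose g2 := - k * (- k - 1) * (a + b * s `^ e) `^ (- k - 1 - 1) * (b * (e * s `^ (e - 1))) ^+ 2
     + - k * (a + b * s `^ e) `^ (- k - 1) * (b * e * ((e - 1) * s `^ (e - 1 - 1))).
have dG : \forall t \near s, is_derive (t : R) (1 : R) G (G1 t).
  by apply: filterS (near_gt0 s0) => t t0; exact: is_derive_cone_profile.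
have dG1 : is_derive (s : R) (1 : R) G1 g2 by exact: is_derive_cone_profile1.
have near' : \forall x \near x0, G (dot (x - y) (x - y)) - G s <= u x - u x0.
  by apply: filterS near_le => x; rewrite uE lerD2r.
have := touch_radial n2 hG hpos hmu mu0 hu Ox0 ux0 dG dG1 near'; rewrite /= -/s -/N.
set h := a + b * s `^ e; have h0 : 0 < h by rewrite addr_gt0// mulr_gt0// powR_gt0.
(* Every power is written through Q and S, so that the remaining identities are polynomial. *)
set Q := h `^ (- k - 1 - 1); have Q0 : 0 < Q by rewrite powR_gt0.
set S := s `^ (e - 1 - 1); have S0 : 0 < S by rewrite powR_gt0.
have PE : h `^ (- k - 1) = h * Q by rewrite powR_succ.
have s1E : s `^ (e - 1) = s * S by rewrite powR_succ.
have seE : s `^ e = s ^+ 2 * S by rewrite powR_succ// s1E expr2 mulrA.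
have uE' : u x0 = h ^+ 2 * Q by rewrite uE -/h powR_succ// PE expr2 mulrA.
have hE : h = a + b * (s ^+ 2 * S) by rewrite /h seE.
have G1E : G1 s = - k * (h * Q) * (b * (e * (s * S))) by rewrite /G1 -/h PE s1E.
have g2E : g2 = - k * (- k - 1) * Q * (b * (e * (s * S))) ^+ 2
     + - k * (h * Q) * (b * e * ((e - 1) * S)) by rewrite /g2 -/h -/Q -/S PE s1E.
have NE : N = k * (1 - mu) + 2 by rewrite kE subrK.
have -> : - (2 * (N - 2) * u x0 * G1 s) - 4 * G1 s ^+ 2 * s =
    2 * (k * h * Q) ^+ 2 * (b * e * s * S) * ((1 - mu) * h - 2 * e * (b * (s ^+ 2 * S))).
  by rewrite G1E uE' -kE; ring.
rewrite G1E uE' g2E NE.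
have c0 : 0 < 2 * (k * h * Q) ^+ 2 * (b * e * s * S).
  by rewrite !mulr_gt0// exprn_gt0// !mulr_gt0.
(* The last factor is (1 - mu) a + (1 - mu - 2 e) t, with t the power term of h, hence positive. *)
rewrite mulr_gt0//; last first.
  have t0 : 0 < b * (s ^+ 2 * S) by rewrite !mulr_gt0// exprn_gt0.
  rewrite hE; move: (b * _) t0 => t t0; nra.
move=> /(_ isT); apply/negP; rewrite -ltNge.
(* The final factor equals 2 e - (1 - mu), which the choice of exponent makes negative. *)
rewrite [X in X < _](_ : _ = 2 * (k * h * Q) ^+ 2 * (b * e * s * S) * ((1 - mu) * h) * (1 + mu + 2 * (e - 1))).
  rewrite nmulr_llt0; first by rewrite mulr_gt0// mulr_gt0// subr_gt0.
  lra.
by ring.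
Qed.

End Barrier.

(** * Inverse powers and perturbation of the exponent *)

Section NegativePowers.
Context {R : realType}.
Implicit Types (p r x y c : R).

Lemma ltr_powRN p x y : 0 < p -> 0 < x -> 0 < y -> (x `^ (- p) < y `^ (- p)) = (y < x).
Proof.
move=> p0 x0 y0; rewrite !powRN ltf_pV2 ?posrE ?powR_gt0//.
apply/idP/idP; last by apply: gt0_ltr_powR => //; rewrite nnegrE ltW.
by apply: contraTT; rewrite -!leNgt; apply: ge0_ler_powR; rewrite ?nnegrE ?ltW.
Qed.

Lemma ler_powRN p x y : 0 < p -> 0 < x -> 0 < y -> (x `^ (- p) <= y `^ (- p)) = (y <= x).
Proof. by move=> p0 x0 y0; rewrite leNgt ltr_powRN// -leNgt. Qed.

Lemma powRNK p x : 0 < p -> 0 <= x -> (x `^ (- p^-1)) `^ (- p) = x.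
Proof.
by move=> p0 x0; rewrite -powRrM mulrNN mulVf ?powRr1// gt_eqF.
Qed.

Lemma powRNVK p x : 0 < p -> 0 <= x -> (x `^ (- p)) `^ (- p^-1) = x.
Proof.
by move=> p0 x0; rewrite -powRrM mulrNN mulfV ?powRr1// gt_eqF.
Qed.

Lemma powR_exponent_cont c : 0 < c -> continuous (fun r => c `^ r).
Proof.
move=> c0 r; rewrite /powR (gt_eqF c0).
apply: (@continuous_comp _ _ _ (fun r => r * ln c) expR); last exact: continuous_expR.
by apply: (@cvgM _ _ (nbhs r) _ id (fun=> ln c)); [exact: cvg_id|exact: cvg_cst].
Qed.

(** A strict violation of the cone bound survives a slightly larger slope and a slightly smaller
    exponent, by continuity in both. *)
Lemma powR_steepen (a b c K E w1 : R) : 0 < c -> 0 < E -> 0 < K -> a + b * (K * c `^ E) < w1 ->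
  exists b' e, [/\ b < b', 0 < e, e < E & a + b' * (K * c `^ e) < w1].
Proof.
move=> c0 E0 K0 lt1; have cE0 : 0 < c `^ E by rewrite powR_gt0.
(* This increment of the slope uses up half of the gap. *)
pose t := (w1 - (a + b * (K * c `^ E))) / (2 * (K * c `^ E)).
have t0 : 0 < t by rewrite divr_gt0 ?subr_gt0// !mulr_gt0.
have lt2 : a + (b + t) * (K * c `^ E) < w1.
  have tE : t * (K * c `^ E) = (w1 - (a + b * (K * c `^ E))) / 2.
    by rewrite /t; field; rewrite !lt0r_neq0.
  lra.
have cont : (fun r => a + (b + t) * (K * c `^ r)) @ E --> a + (b + t) * (K * c `^ E).
  apply: cvgD; first exact: cvg_cst.
  apply: cvgM; first exact: cvg_cst.
  apply: cvgM; first exact: cvg_cst.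
  exact: powR_exponent_cont.
have /nbhs_ballP[d /= d0 dlt] : \forall r \near E, a + (b + t) * (K * c `^ r) < w1.
  exact: (cvgr_lt _ cont).
pose m := Num.min d E; have m0 : 0 < m by rewrite lt_min d0.
exists (b + t), (E - m / 2); split.
- by rewrite ltrDl.
- have : m <= E by rewrite ge_min lexx orbT.
  lra.
- lra.
- apply: dlt; rewrite /ball/= opprB addrC subrK gtr0_norm; last lra.
  have : m <= d by rewrite ge_min lexx.
  lra.
Qed.

End NegativePowers.

(** * Comparison of [w] with cones *)

Section Comparison.
Context {R : realType} {n : nat}.
Variables (Gamma Omega : set 'rV[R]_n) (mu k : R) (u : 'rV[R]_n -> R).
Hypotheses (n2 : (2 < n)%N)
  (hG : open_convex_symmetric_cone Gamma)
  (hpos : [set lam : 'rV[R]_n | forall i, 0 < lam 0 i] `<=` Gamma)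
  (htr : Gamma `<=` [set lam : 'rV[R]_n | 0 < \sum_(i < n) lam 0 i])
  (hmu : is_mu_plus Gamma mu) (mu0 : 0 <= mu) (mu1 : mu < 1)
  (k0 : 0 < k) (kE : k * (1 - mu) = n%:R - 2)
  (hu : viscosity_sol Gamma Omega u)
  (upos : forall x, Omega x -> 0 < u x)
  (ulsc : forall x, Omega x -> forall a, a < u x -> \forall y \near x, a < u y).
Hypothesis (oO : forall x, Omega x -> \forall y \near x, Omega y).

Let w x := u x `^ (- k^-1).

Lemma w_gt0 x : Omega x -> 0 < w x.
Proof. by move=> /upos ux; rewrite powR_gt0. Qed.

(** The negative exponent reverses the order and so turns lower into upper semicontinuity. *)
Lemma w_usc x : Omega x -> forall A, w x < A -> \forall y \near x, w y < A.
Proof.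
move=> Ox A wA; have A0 := lt_trans (w_gt0 Ox) wA.
have ki : 0 < k^-1 by rewrite invr_gt0.
have uA : A `^ (- k) < u x.
  by rewrite -(@ltr_powRN _ k^-1) ?powR_gt0 ?upos// powRNVK// ltW.
near=> y.
have Oy : Omega y by near: y; exact: oO.
have : A `^ (- k) < u y by near: y; exact: ulsc.
by rewrite -(@ltr_powRN _ k^-1) ?powR_gt0 ?upos// powRNVK// ltW.
Unshelve. all: by end_near. Qed.

Lemma lsc_subr (g f : 'rV[R]_n -> R) x : {for x, continuous g} ->
  (forall A, f x < A -> \forall y \near x, f y < A) ->
  forall a, a < g x - f x -> \forall y \near x, a < g y - f y.
Proof.
move=> cg uf a agf; pose d := (g x - f x - a) / 2.
have d0 : 0 < d by rewrite divr_gt0// subr_gt0.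
near=> y.
have h1 : f y < f x + d by near: y; apply: uf; rewrite ltrDl.
have h2 : g x - d < g y by near: y; apply: (cvgr_gt _ cg); rewrite gtrBl.
by rewrite /d in h1 h2; lra.
Unshelve. all: by end_near. Qed.

Lemma dist_powR_cont (y x : 'rV[R]_n) (r : R) : x != y ->
  {for x, continuous (fun x : 'rV[R]_n => dot (x - y) (x - y) `^ r)}.
Proof.
move=> xy; have s0 : 0 < dot (x - y) (x - y).
  by rewrite -enorm_sqr exprn_gt0// enorm_gt0 subr_eq0.
apply: (@continuous_comp _ _ _ (fun x : 'rV[R]_n => dot (x - y) (x - y)) (fun t => t `^ r)); last exact: powR_cont.
have -> : (fun x : 'rV[R]_n => dot (x - y) (x - y)) = (fun x => enorm (x - y) * enorm (x - y)).
  by apply/funext => z; rewrite -enorm_sqr expr2.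
by apply: (@cvgM _ _ (nbhs x) _ (fun x : 'rV[R]_n => enorm (x - y)) (fun x => enorm (x - y)));
  exact: enorm_dist_continuous.
Qed.

Lemma enorm_powR (x : 'rV[R]_n) (r : R) : enorm x `^ r = dot x x `^ (r / 2).
Proof. by rewrite -enorm_sqr -powR_mulrn ?enorm_ge0// -powRrM mulrC divfK. Qed.

(** If the bound failed, a cone h of larger slope and slightly smaller exponent would still fail,
    and w - h would have a positive maximum on D at some x0. The alternative in the hypothesis makes
    x0 interior to D; raising h by the maximum makes its power -k touch u from below, against
    [cone_barrier_strict]. *)
Lemma cone_comparison (D : set 'rV[R]_n) y (a b : R) :
  compact D -> D `<=` Omega -> ~ D y -> (forall x, D x -> enorm (x - y) <= 2) ->
  0 < a -> 0 <= b ->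
  (forall x, D x -> w x <= a + b * enorm (x - y) `^ (1 - mu) \/ \forall z \near x, D z) ->
  forall x, D x -> w x <= a + b * enorm (x - y) `^ (1 - mu).
Proof.
move=> cD DO nDy D2 a0 b0 bd x1 Dx1; rewrite leNgt; apply/negP => wx1.
have Dney x : D x -> x != y by move=> Dx; apply/eqP => xy; rewrite xy in Dx.
have Ds x : D x -> 0 < dot (x - y) (x - y) / 4 <= 1.
  move=> Dx; rewrite divr_gt0//= -?enorm_sqr ?exprn_gt0 ?enorm_gt0 ?subr_eq0 ?Dney//.
  rewrite ler_pdivrMr// mul1r; have := D2 x Dx; have := enorm_ge0 (x - y); nra.
pose E := (1 - mu) / 2; have E0 : 0 < E by rewrite divr_gt0// subr_gt0.
have four0 : (0 : R) < 4 by [].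
have K0 : 0 < (4 : R) `^ E by rewrite powR_gt0.
have split4 (x : 'rV[R]_n) (r : R) : dot (x - y) (x - y) `^ r = 4 `^ r * (dot (x - y) (x - y) / 4) `^ r.
  by rewrite -powRM ?divr_ge0 ?dot_ge0// mulrC divfK.
have /andP[c0 c1] := Ds _ Dx1.
have : a + b * (4 `^ E * (dot (x1 - y) (x1 - y) / 4) `^ E) < w x1.
  by rewrite -split4 -enorm_powR.
(* Since |x - y| / 2 <= 1, a smaller exponent increases the barrier. *)
move=> /(powR_steepen c0 E0 K0)[b' [e [bb' e0 eE lt1]]].
have b'0 : 0 < b' by exact: le_lt_trans bb'.
(* In terms of |x - y|^2 / 4 the function h then differs from the original cone only in the slope b'
   and the exponent e. *)
pose B := b' * (4 `^ (E - e)); have B0 : 0 < B by rewrite mulr_gt0// powR_gt0.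
pose h x := a + B * dot (x - y) (x - y) `^ e.
have hE x : h x = a + b' * (4 `^ E * (dot (x - y) (x - y) / 4) `^ e).
  rewrite /h split4 /B mulrA -(mulrA b') -powRD ?subrK ?mulrA//.
  by rewrite pnatr_eq0 implybT.
have hge x : D x -> a + b * enorm (x - y) `^ (1 - mu) <= h x.
  move=> Dx; rewrite enorm_powR -/E hE split4 lerD2l.
  apply: ler_pM => //; first by rewrite mulr_ge0 ?powR_ge0.
    exact: ltW.
  by rewrite ler_pM2l//; apply: ger_powR; [exact: Ds|exact: ltW].
have hcont x : D x -> {for x, continuous h}.
  move=> Dx; apply: (@cvgD _ _ _ (nbhs x) _ (fun=> a)); first exact: cvg_cst.
  apply: (@cvgM _ _ (nbhs x) _ (fun=> B)); first exact: cvg_cst.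
  by apply: dist_powR_cont; exact: Dney.
have [||x0 Dx0 minx0] := @lsc_min _ R D (fun x => h x - w x) _ cD.
- by exists x1.
- by move=> x Dx; apply: lsc_subr; [exact: hcont|apply: w_usc; exact: DO].
pose m := w x0 - h x0.
have m0 : 0 < m.
  have := minx0 x1 Dx1; move: lt1; rewrite -hE /m; lra.
have Ox0 := DO _ Dx0.
have [wle|nearD] := bd _ Dx0.
  by have := hge _ Dx0; rewrite /m in m0; lra.
have ki : 0 < k^-1 by rewrite invr_gt0.
apply: (@cone_barrier_strict R n Gamma Omega mu u n2 hG hpos hmu mu0 mu1 hu (a + m) B e k x0 y) => //.
- exact: upos.
- by rewrite eq_sym; exact: Dney.
- exact: addr_gt0.
- by move: eE; rewrite /E; lra.
- rewrite -[LHS](@powRNK _ k)// ?ltW ?upos//; congr (_ `^ _).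
  by rewrite -/(w x0) /m /h; ring.
- apply: filterS nearD => x Dx; have := minx0 x Dx => le0.
  rewrite -(powRNK k0 (ltW (upos (DO _ Dx)))) ler_powRN//.
  - by rewrite -/(w x); move: le0; rewrite /m /h; lra.
  - apply: addr_gt0; first exact: addr_gt0.
    by rewrite mulr_gt0 ?powR_gt0// -enorm_sqr exprn_gt0// enorm_gt0 subr_eq0 Dney.
  - exact: w_gt0 (DO _ Dx).
Qed.

End Comparison.

(** * Comparison of [u] with harmonic functions *)

Lemma trmx_symD (R : realType) (n : nat) (A B : 'M[R]_n) : A^T = A -> B^T = B -> (A + B)^T = A + B.
Proof. by move=> AT BT; rewrite linearD/= AT BT. Qed.

Section Superharmonic.
Context {R : realType} {n : nat}.
Variables (Gamma Omega : set 'rV[R]_n) (u : 'rV[R]_n -> R).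
Hypotheses (n2 : (2 < n)%N)
  (htr : Gamma `<=` [set lam : 'rV[R]_n | 0 < \sum_(i < n) lam 0 i])
  (hu : viscosity_sol Gamma Omega u)
  (upos : forall x, Omega x -> 0 < u x)
  (ulsc : forall x, Omega x -> forall a, a < u x -> \forall y \near x, a < u y).

Let N : R := n%:R.

(** The shape of the Hessian at x0 of a function of |x - y|^2, with z = x0 - y. *)
Definition radial_hess (a b : R) (z : 'rV[R]_n) : 'M[R]_n :=
  a *: (z^T *m z) + b%:M.

Lemma radial_hess_sym a b z : (radial_hess a b z)^T = radial_hess a b z.
Proof.
by rewrite /radial_hess linearD/= linearZ/= trmx_mul trmxK tr_scalar_mx.
Qed.

Lemma tr_radial_hess a b z : \tr (radial_hess a b z) = a * dot z z + N * b.
Proof. by rewrite mxtraceD mxtraceZ mxtrace_rank1 mxtrace_scalar -mulr_natl. Qed.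

(** |x - y|^(2 - N) is harmonic away from y; as a function of s = |x - y|^2 it is s^e with e = (2 -
    N) / 2. *)
Lemma lower_jet_fundamental (c : R) x0 y : x0 != y ->
  exists p a b, lower_jet (fun x : 'rV[R]_n => c * enorm (x - y) `^ (2 - N)) x0 p (radial_hess a b (x0 - y))
    /\ \tr (radial_hess a b (x0 - y)) = 0.
Proof.
move=> xy; pose s := dot (x0 - y) (x0 - y).
have s0 : 0 < s by rewrite /s -enorm_sqr exprn_gt0// enorm_gt0 subr_eq0.
pose e := (2 - N) / 2.
pose G1 t := c * (e * t `^ (e - 1)).
pose g2 := c * e * ((e - 1) * s `^ (e - 1 - 1)).
have dG : \forall t \near s, is_derive (t : R) (1 : R) (fun t => c * t `^ e) (G1 t).
  by apply: filterS (near_gt0 s0) => t t0; exact: is_derive_powRZ.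
have dG1 : is_derive (s : R) (1 : R) G1 g2.
  have -> : G1 = fun t => c * e * t `^ (e - 1) by apply/funext => t; rewrite /G1 mulrA.
  exact: is_derive_powRZ.
exists ((2 * G1 s) *: (x0 - y)), (4 * g2), (2 * G1 s); split.
  have := lower_jet_radial dG dG1.
  by under eq_fun do rewrite -enorm_powR.
rewrite tr_radial_hess -/s /g2 /G1 [s `^ (e - 1)]powR_succ// /e.
by move: (s `^ _) => S; field.
Qed.

Lemma lower_jet_square (t : R) x0 : lower_jet (fun x : 'rV[R]_n => t * dot (x - 0) (x - 0)) x0
  ((2 * t) *: (x0 - 0)) (radial_hess (4 * 0) (2 * t) (x0 - 0)).
Proof.
apply: (@lower_jet_radial R n (fun s => t * s) (fun=> t) 0 x0 0).
  apply/nbhs_ballP; exists 1 => //= s _.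
  have := is_deriveZ t (is_derive_id (s : R) (1 : R)).
  by rewrite /GRing.scale/= mulr1.
Qed.

(** Let psi be phi plus t (|x|^2 - 1). At a minimum point x0 of u - psi on D this difference is
    negative, so x0 is interior. Both poles lie outside D, so the Hessian of psi has trace 2 t N > 0
    there, which [touch_trace] forbids. *)
Lemma superharmonic_comparison (D : set 'rV[R]_n) y (al be ga : R) :
  let phi x := al * enorm x `^ (2 - N) + be * enorm (x - y) `^ (2 - N) + ga in
  compact D -> D `<=` Omega -> ~ D 0 -> ~ D y -> (forall x, D x -> enorm x <= 1) ->
  (forall x, D x -> phi x <= u x \/ \forall z \near x, D z) ->
  forall x, D x -> phi x <= u x.
Proof.
move=> phi cD DO nD0 nDy D1 bd x1 Dx1; rewrite leNgt; apply/negP => ux1.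
have Dne x z : D x -> ~ D z -> x != z by move=> Dx nDz; apply/eqP => xz; rewrite xz in Dx.
(* Adding t (|x|^2 - 1) makes the harmonic barrier strictly subharmonic. *)
pose t := (phi x1 - u x1) / 2.
have t0 : 0 < t by rewrite divr_gt0// subr_gt0.
pose psi x := al * enorm (x - 0) `^ (2 - N) + be * enorm (x - y) `^ (2 - N)
   + (ga - t) + t * dot (x - 0) (x - 0).
have psiE x : psi x = phi x - t + t * dot x x by rewrite /psi /phi !subr0; ring.
have psile x : D x -> psi x <= phi x.
  move=> Dx; rewrite psiE -addrA gerDl addrC subr_le0 ger_pMr// -enorm_sqr.
  by rewrite expr_le1// ?enorm_ge0// D1.
have fundcont c z x : D x -> ~ D z -> {for x, continuous (fun x : 'rV[R]_n => c * enorm (x - z) `^ (2 - N))}.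
  move=> Dx nDz; apply: (@cvgM _ _ (nbhs x) _ (fun=> c)); first exact: cvg_cst.
  under [X in X @ _ --> _]eq_fun do rewrite enorm_powR.
  by rewrite enorm_powR; apply: dist_powR_cont; exact: Dne nDz.
have sqcont : continuous (fun x : 'rV[R]_n => t * dot (x - 0) (x - 0)).
  move=> x; apply: (@cvgM _ _ (nbhs x) _ (fun=> t)); first exact: cvg_cst.
  have -> : (fun x : 'rV[R]_n => dot (x - 0) (x - 0)) = (fun x => enorm (x - 0) * enorm (x - 0)).
    by apply/funext => z; rewrite -enorm_sqr expr2.
  by rewrite -enorm_sqr expr2; apply: (@cvgM _ _ (nbhs x) _ (fun x : 'rV[R]_n => enorm (x - 0)) (fun x : 'rV[R]_n => enorm (x - 0)));
    exact: enorm_dist_continuous.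
have psicont x : D x -> {for x, continuous psi}.
  move=> Dx.
  apply: (@cvgD _ _ _ (nbhs x) _ _ (fun x : 'rV[R]_n => t * dot (x - 0) (x - 0))); last exact: sqcont.
  apply: (@cvgD _ _ _ (nbhs x) _ _ (fun=> ga - t)); last exact: cvg_cst.
  apply: (@cvgD _ _ _ (nbhs x) _ (fun x : 'rV[R]_n => al * enorm (x - 0) `^ (2 - N))
     (fun x : 'rV[R]_n => be * enorm (x - y) `^ (2 - N))); exact: fundcont.
have [||x0 Dx0 minx0] := @lsc_min _ R D (fun x => u x - psi x) _ cD.
- by exists x1.
- move=> x Dx a au.
  pose d := (u x - psi x - a) / 2.
  have d0 : 0 < d by rewrite divr_gt0// subr_gt0.
  near=> z.
  have h1 : u x - d < u z by near: z; apply: ulsc; [exact: DO|rewrite gtrBl].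
  have h2 : psi z < psi x + d by near: z; apply: (cvgr_lt _ (psicont x Dx)); rewrite ltrDl.
  by rewrite /d in h1 h2; lra.
have lt0 : u x0 - psi x0 < 0.
  apply: le_lt_trans (minx0 _ Dx1) _; rewrite psiE.
  have : 0 <= t * dot x1 x1 by rewrite mulr_ge0 ?dot_ge0 ?ltW.
  rewrite /t; lra.
have Ox0 := DO _ Dx0.
have [wle|nearD] := bd _ Dx0.
  by move: lt0; rewrite subr_lt0 ltNge (le_trans (psile _ Dx0)).
have x00 : x0 != 0 := Dne _ _ Dx0 nD0.
have x0y : x0 != y := Dne _ _ Dx0 nDy.
have [p1 [a1 [b1 [j1 tr1]]]] := lower_jet_fundamental al x00.
have [p2 [a2 [b2 [j2 tr2]]]] := lower_jet_fundamental be x0y.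
have jet := lower_jetD (lower_jetD (lower_jetD j1 j2) (lower_jet_cst (ga - t) x0)) (lower_jet_square t x0).
suff : \tr (radial_hess a1 b1 (x0 - 0) + radial_hess a2 b2 (x0 - y) + 0 + radial_hess (4 * 0) (2 * t) (x0 - 0)) <= 0.
  rewrite 3!mxtraceD tr1 tr2 mxtrace0 !add0r tr_radial_hess mulr0 mul0r add0r leNgt.
  have N0 : 0 < N by rewrite ltr0n (leq_trans _ n2).
  by move/negP; apply; apply: mulr_gt0 => //; apply: mulr_gt0.
apply: (touch_trace n2 htr hu Ox0 (upos Ox0) _ jet).
  have S := radial_hess_sym.
  exact: trmx_symD (trmx_symD (trmx_symD (S _ _ _) (S _ _ _)) (trmx0 _ _ _)) (S _ _ _).
apply: filterS nearD => x Dx; have := minx0 x Dx; rewrite -/(psi x) -/(psi x0).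
rewrite -subr_ge0 => h; rewrite -subr_ge0; apply: le_trans h _.
by rewrite le_eqVlt; apply/orP; left; apply/eqP; ring.
Unshelve. all: by end_near. Qed.

End Superharmonic.

(** * Closed annuli *)

Section Annulus.
Context {R : realType} {n : nat}.
Implicit Types (x y : 'rV[R]_n) (r : R).

Definition annulus y r1 r2 : set 'rV[R]_n := [set x | r1 <= enorm (x - y) <= r2].

Lemma annulus_compact y r1 r2 : compact (annulus y r1 r2).
Proof.
apply: (@enorm_compact _ _ _ (r2 + enorm y)).
  have -> : annulus y r1 r2 = [set x | r1 <= enorm (x - y)] `&` [set x | enorm (x - y) <= r2].
    by apply/seteqP; split=> x /= => [/andP//|[x1 x2]]; rewrite /annulus/= x1 x2.
  by apply: closedI; [exact: enorm_closed_ge|exact: enorm_closed_le].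
move=> x /andP[_ xr2]; apply: le_trans (ler_enorm_dist x y) _.
by rewrite lerD2r.
Qed.

Lemma annulus_center y r1 r2 : 0 < r1 -> ~ annulus y r1 r2 y.
Proof. by move=> r10; rewrite /annulus/= subrr enorm0 leNgt r10. Qed.

Lemma enorm_dist_near y x r : enorm (x - y) < r -> \forall z \near x, enorm (z - y) < r.
Proof. by move=> xr; exact: (cvgr_lt _ (@enorm_dist_continuous _ _ y x)). Qed.

Lemma enorm_dist_near_gt y x r : r < enorm (x - y) -> \forall z \near x, r < enorm (z - y).
Proof. by move=> xr; exact: (cvgr_gt _ (@enorm_dist_continuous _ _ y x)). Qed.

Lemma annulus_near y r1 r2 x : r1 < enorm (x - y) < r2 -> \forall z \near x, annulus y r1 r2 z.
Proof.
move=> /andP[x1 x2]; near=> z; apply/andP; split; apply: ltW; near: z.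
  exact: enorm_dist_near_gt.
exact: enorm_dist_near.
Unshelve. all: by end_near. Qed.

(** Supplies the alternative, boundary or interior, that the comparison principles ask for. *)
Lemma annulus_cases y r1 r2 x : annulus y r1 r2 x ->
  [\/ enorm (x - y) = r1, enorm (x - y) = r2 | \forall z \near x, annulus y r1 r2 z].
Proof.
move=> /andP[]; rewrite le_eqVlt => /predU1P[->|x1]; first by constructor 1.
rewrite le_eqVlt => /predU1P[->|x2]; first by constructor 2.
by constructor 3; apply: annulus_near; rewrite x1.
Qed.

Lemma sphere_neq0 r : (0 < n)%N -> 0 <= r -> exists x, enorm x = r.
Proof.
move=> n0 r0; exists (r *: delta_mx 0 (Ordinal n0)).
rewrite enormZ ger0_norm// enormE dot_delta mxE !eqxx sqrtr1 mulr1//.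
Qed.

End Annulus.

(** * Hölder norms, limits at the origin and elementary inequalities *)

Lemma powRN_lip (R : realType) (k m a b : R) : 0 < k -> 0 < m -> m <= a -> m <= b ->
  `|a `^ (- k) - b `^ (- k)| <= k * m `^ (- k - 1) * `|a - b|.
Proof.
move=> k0 m0 ma mb; wlog ab : a b ma mb / a <= b.
  by move=> h; case/orP: (le_total a b) => ?; [|rewrite distrC (distrC a)]; apply: h.
have a0 : 0 < a := lt_le_trans m0 ma.
have dp c : c \in `]a, b[ -> is_derive (c : R) (1 : R) (@powR R ^~ (- k)) (- k * c `^ (- k - 1)).
  by rewrite in_itv/= => /andP[ac _]; apply: is_derive1_powR; exact: lt_trans ac.
have cont : {within `[a, b], continuous (@powR R ^~ (- k))}.
  apply: derivable_within_continuous => c; rewrite in_itv/= => /andP[ac _].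
  by have [] := @is_derive1_powR R (- k) c (lt_le_trans a0 ac).
have [c cab e] := MVT_segment ab dp cont.
have /andP[ac cb] : a <= c <= b by move: cab; rewrite in_itv.
(* The derivative has absolute value k c^(- k - 1), largest at the lower bound m. *)
rewrite distrC e normrM (distrC a) ler_wpM2r// normrM normrN (gtr0_norm k0).
rewrite ler_pM2l// ger0_norm ?powR_ge0// -opprD.
by rewrite ler_powRN ?addr_gt0//; [exact: le_trans ma ac|exact: lt_le_trans a0 ac].
Qed.

Lemma holder_norm_le (R : realType) (n : nat) (al S C : R) (D : set 'rV[R]_n) f :
  0 <= C -> (forall x, D x -> `|f x| <= S) ->
  (forall x y, D x -> D y -> `|f x - f y| <= C * enorm (x - y) `^ al) ->
  (holder_norm al D f <= (S + C)%:E)%E.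
Proof.
move=> C0 fS fC; rewrite /holder_norm EFinD; apply: leeD.
  by apply: ge_ereal_sup => _ [x Dx <-]; rewrite lee_fin fS.
apply: ge_ereal_sup => _ [[x y] [/= Dx Dy] <-]; rewrite lee_fin.
(* A quotient with zero denominator has the value 0. *)
have [e0|e0] := eqVneq (enorm (x - y) `^ al) 0; first by rewrite e0 invr0 mulr0.
by rewrite ler_pdivrMr ?fC// lt_neqAle eq_sym e0 powR_ge0.
Qed.

Lemma dnbhs0_enorm (R : realType) (n : nat) (P : set 'rV[R]_n) :
  (\forall x \near (0 : 'rV[R]_n)^', P x) <->
  exists2 e : R, 0 < e & forall x, 0 < enorm x < e -> P x.
Proof.
rewrite near_withinE /=; split.
  move=> /nbhs_enorm[e e0 eP]; exists e => // x /andP[x0 xe].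
  by apply: eP; rewrite ?subr0// -enorm_gt0.
move=> [e e0 eP]; apply/nbhs_enorm; exists e => // x.
by rewrite subr0 => xe x0; apply: eP; rewrite enorm_gt0 x0.
Qed.

(** Needed because u(0) is prescribed as a lower limit, while the estimates for w produce a
    limit. *)
Lemma limf_einf_dnbhs0 (R : realType) (n : nat) (f : 'rV[R]_n -> R) (l : R) : (0 < n)%N ->
  f x @[x --> (0 : 'rV[R]_n)^'] --> l ->
  l%:E = limf_einf (fun x : 'rV[R]_n => (f x)%:E) (0 : 'rV[R]_n)^'.
Proof.
move=> n0 /cvgrPdist_lt fl; rewrite limf_einfE; apply/eqP; rewrite eq_le; apply/andP; split.
  apply/lee_addgt0Pr => e e0; rewrite -leeBlDr//.
  apply: le_ereal_sup_tmp; exists (ereal_inf ((fun x => (f x)%:E) @` [set x | `|l - f x| < e])).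
    by exists [set x | `|l - f x| < e] => //; exact: fl.
  apply: le_ereal_inf_tmp => _ [x /= + <-]; rewrite -EFinB lee_fin ltr_norml => /andP[_]; lra.
apply: ge_ereal_sup => _ [V FV <-]; apply/lee_addgt0Pr => e e0.
have /dnbhs0_enorm[d d0 dV] := FV; have /dnbhs0_enorm[d' d'0 d'P] := fl e e0.
have m0 : 0 < Num.min d d' by rewrite lt_min d0.
have m2 : 0 < Num.min d d' / 2 by rewrite divr_gt0.
have [x xE] := @sphere_neq0 R n _ n0 (ltW m2).
have xm : enorm x < Num.min d d' by rewrite xE; lra.
have x0 : 0 < enorm x by rewrite xE.
move: xm; rewrite lt_min => /andP[xd xd'].
apply: (@le_trans _ _ (f x)%:E).
  by apply: ereal_inf_lbound; exists x => //; apply: dV; rewrite x0.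
have : `|l - f x| < e by apply: d'P; rewrite x0.
rewrite -EFinD lee_fin ltr_norml => /andP[]; lra.
Qed.

(** This and the next four inequalities are the arithmetic of [sphere_improvement]. In the first
    three, X, Q and P stand for c' |z|^(2 - N), e |z|^(2 - N) and A (3 |y|)^(2 - N). *)
Lemma le_barrier1 (R : realDomainType) (X Q P c s F U : R) :
  (c + 2 * s) * F <= U -> X <= (c + s) * F -> 0 < P -> 0 < Q -> X - Q + s * F - P <= U.
Proof. lra. Qed.

Lemma le_barrier2 (R : realDomainType) (X Q P Y U : R) :
  X <= U -> 0 < P -> Y <= Q -> X - Q + Y - P <= U.
Proof. lra. Qed.

Lemma le_barrier3 (R : realDomainType) (X Q P U : R) : X <= U -> 0 < Q -> X - Q + P - P <= U.
Proof. lra. Qed.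

Lemma le_barrier4 (R : realDomainType) (a b : R) : a <= 3 * b -> 4 * b <= a + b -> a = 3 * b.
Proof. lra. Qed.

Lemma le_barrier5 (R : realDomainType) (c e F P P2 Q U : R) :
  (c - e) * F + P + - Q <= U -> P2 <= P -> c * F + P2 - Q <= U + e * F.
Proof. lra. Qed.

(** * Sphere maxima of [w] and cone estimates near the origin *)

Section Global.
Context {R : realType} {n : nat}.
Variables (u : 'rV[R]_n -> R) (k kap : R).
Hypotheses (n2 : (2 < n)%N) (k0 : 0 < k) (kap0 : 0 < kap) (kap1 : kap <= 1)
  (kE : k * kap = n%:R - 2).
Let N : R := n%:R.
Let Omega : set 'rV[R]_n := eball 1 `\ 0.
Let w x := u x `^ (- k^-1).
Hypotheses (upos : forall x, Omega x -> 0 < u x)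
  (wusc : forall x, Omega x -> forall A, w x < A -> \forall y \near x, w y < A)
  (CC : forall (D : set 'rV[R]_n) y (a b : R),
    compact D -> D `<=` Omega -> ~ D y -> (forall x, D x -> enorm (x - y) <= 2) ->
    0 < a -> 0 <= b ->
    (forall x, D x -> w x <= a + b * enorm (x - y) `^ kap \/ \forall z \near x, D z) ->
    forall x, D x -> w x <= a + b * enorm (x - y) `^ kap)
  (SH : forall (D : set 'rV[R]_n) y (al be ga : R),
    compact D -> D `<=` Omega -> ~ D 0 -> ~ D y ->
    (forall x, D x -> al * enorm x `^ (2 - N) + be * enorm (x - y) `^ (2 - N) + ga <= u x
       \/ \forall z \near x, D z) ->
    forall x, D x -> al * enorm x `^ (2 - N) + be * enorm (x - y) `^ (2 - N) + ga <= u x).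

Lemma OmegaE x : Omega x <-> 0 < enorm x < 1.
Proof.
split=> [[/= x1 x0]|/andP[x0 x1]]; first by rewrite x1 andbT enorm_gt0; exact/eqP.
by split=> //=; apply/eqP; rewrite -enorm_gt0.
Qed.

Let wpos x : Omega x -> 0 < w x.
Proof. by move=> /upos ux; rewrite powR_gt0. Qed.

Lemma wK x : Omega x -> u x = w x `^ (- k).
Proof. by move=> /upos/ltW ux; rewrite powRNK. Qed.

Lemma annulus0_Omega r1 r2 : 0 < r1 -> r2 < 1 -> annulus 0 r1 r2 `<=` Omega.
Proof.
move=> r10 r21 x /andP[]; rewrite subr0 => x1 x2; apply/OmegaE.
by rewrite (lt_le_trans r10)// (le_lt_trans x2).
Qed.

(** The default 0 never occurs for 0 < r < 1: there the upper semicontinuous w attains its maximum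
    on the compact sphere, by [sphere_argmaxP]. *)
Definition sphere_argmax r := xget (0 : 'rV[R]_n)
  [set x | enorm x = r /\ forall y, enorm y = r -> w y <= w x].

Definition sphere_max r := w (sphere_argmax r).

Lemma sphere_argmaxP r : 0 < r < 1 -> enorm (sphere_argmax r) = r /\
  forall y, enorm y = r -> w y <= sphere_max r.
Proof.
move=> /andP[r0 r1]; rewrite /sphere_max /sphere_argmax; case: xgetP => // nex.
exfalso; have n0 : (0 < n)%N by rewrite (leq_trans _ n2).
have [x0 x0r] := sphere_neq0 n0 (ltW r0).
have DE x : annulus 0 r r x <-> enorm x = r.
  by rewrite /annulus/= subr0 -eq_le eq_sym; split => /eqP.
have [||x Dx minx] := @lsc_min _ R (annulus 0 r r) (fun x => - w x) _ (@annulus_compact _ _ _ _ _).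
- by exists x0; apply/DE.
- move=> x /(annulus0_Omega r0 r1) Ox a; rewrite ltrNr => /(wusc Ox).
  by apply: filterS => y; rewrite ltrNr.
- apply: (nex x); split; first exact/DE.
  by move=> y /DE /minx; rewrite lerN2.
Qed.

Lemma sphere_max_ge r x : 0 < r < 1 -> enorm x = r -> w x <= sphere_max r.
Proof. by move=> r01; exact: (sphere_argmaxP r01).2. Qed.

Lemma sphere_max_gt0 r : 0 < r < 1 -> 0 < sphere_max r.
Proof.
by move=> r01; apply: wpos; apply/OmegaE; rewrite (sphere_argmaxP r01).1.
Qed.

Lemma NE : (n%:R : R) - 2 >= 1.
Proof. by have : (3%:R : R) <= n%:R; [rewrite ler_nat|lra]. Qed.

(** Since N - 2 >= 1, the power r^(2 - N) is at least 1 / r when r <= 1. This lets a small multiple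
    of the fundamental solution dominate on a small sphere. *)
Lemma powR_small_radius (A r0 : R) : 0 < r0 <= 1 -> exists2 r, 0 < r <= r0 & A <= r `^ (2 - N).
Proof.
move=> /andP[r00 r01]; pose B := Num.max A 1.
have B0 : 0 < B by rewrite lt_max ltr01 orbT.
have Bi0 : 0 < B^-1 by rewrite invr_gt0.
pose r := Num.min r0 B^-1; have rp : 0 < r by rewrite lt_min r00.
exists r; first by rewrite rp ge_min lexx.
have rB : r <= B^-1 by rewrite ge_min lexx orbT.
have r1 : r <= 1 by rewrite ge_min r01.
apply: (@le_trans _ _ r^-1).
  apply: (@le_trans _ _ B); first by rewrite le_max lexx.
  by rewrite -[leLHS]invrK lef_pV2.
have -> : r^-1 = r `^ (-1) by rewrite powR_inv1// ltW.
apply: ger_powR; first by rewrite rp.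
by have := NE; rewrite -/N; lra.
Qed.

(** Minimum principle on a punctured ball: subtracting e' |x|^(2 - N) makes the barrier nonpositive
    on a small sphere, so the puncture is harmless as e' tends to 0. *)
Lemma u_ge_sphere rho x : 0 < rho < 1 -> 0 < enorm x <= rho ->
  sphere_max rho `^ (- k) <= u x.
Proof.
move=> rho01 /andP[x0 xrho]; have /andP[rho0 rho1] := rho01.
set m := _ `^ _; have m0 : 0 < m by rewrite powR_gt0// sphere_max_gt0.
apply/ler_addgt0Pl => e e0.
(* The correction equals e at the point x; r is then so small that the correction is at least m on
   the sphere of radius r. *)
pose e' := e / enorm x `^ (2 - N).
have e'0 : 0 < e' by rewrite divr_gt0// powR_gt0.
have [|r /andP[r0 rx] rbig] := @powR_small_radius (m / e') (enorm x).
  by rewrite x0 (le_trans xrho)// ltW.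
have := @SH (annulus 0 r rho) 0 (- e') 0 m (@annulus_compact _ _ _ _ _) (annulus0_Omega r0 rho1).
have nD0 := @annulus_center _ _ (0 : 'rV[R]_n) r rho r0.
move=> /(_ nD0 nD0) /(_ _ x); rewrite mul0r addr0.
have -> : - e' * enorm x `^ (2 - N) = - e.
  by rewrite /e' mulNr divfK// gt_eqF// powR_gt0.
rewrite -lerBlDl [m - e]addrC; apply.
  move=> y Dy; have Oy := annulus0_Omega r0 rho1 Dy.
  rewrite mul0r addr0; case: (annulus_cases Dy); rewrite ?subr0 => yE.
  - left; rewrite yE mulNr addrC; apply: le_trans (ltW (upos Oy)).
    by rewrite subr_le0 mulrC -ler_pdivrMr.
  - left; rewrite (wK Oy); apply: (@le_trans _ _ m).
      by rewrite gerDr mulNr oppr_le0 mulr_ge0 ?powR_ge0 ?ltW.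
    rewrite ler_powRN//; [|exact: sphere_max_gt0|exact: wpos].
    exact: sphere_max_ge.
  - by right.
by rewrite /annulus/= subr0 rx.
Qed.

Lemma w_le_sphere rho x : 0 < rho < 1 -> 0 < enorm x <= rho -> w x <= sphere_max rho.
Proof.
move=> rho01 xrho; have Ox : Omega x.
  by apply/OmegaE; case/andP: xrho => -> xr; rewrite (le_lt_trans xr)//; case/andP: rho01.
have := u_ge_sphere rho01 xrho; rewrite (wK Ox) ler_powRN//.
- exact: sphere_max_gt0.
- exact: wpos.
Qed.

Lemma sphere_max_homo r s : 0 < r -> r <= s -> s < 1 -> sphere_max r <= sphere_max s.
Proof.
move=> r0 rs s1; have r01 : 0 < r < 1 by rewrite r0 (le_lt_trans rs).
apply: w_le_sphere; first by rewrite (lt_le_trans r0).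
by rewrite (sphere_argmaxP r01).1 r0.
Qed.

(** By monotonicity also the limit of [sphere_max r] as r tends to 0. *)
Definition wlim := inf [set sphere_max r | r in [set r : R | 0 < r < 1]].

Lemma wlim_has_inf : has_inf [set sphere_max r | r in [set r : R | 0 < r < 1]].
Proof.
split; first by exists (sphere_max (2^-1)), (2^-1) => //=; apply/andP; split; lra.
by exists 0 => _ [r r01 <-]; rewrite ltW// sphere_max_gt0.
Qed.

Lemma wlim_ge0 : 0 <= wlim.
Proof.
apply: lb_le_inf; first exact: wlim_has_inf.1.
by move=> _ [r r01 <-]; rewrite ltW// sphere_max_gt0.
Qed.

Lemma wlim_le r : 0 < r < 1 -> wlim <= sphere_max r.
Proof. by move=> r01; apply: ge_inf; [exact: wlim_has_inf.2|exists r]. Qed.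

Lemma wlim_near e : 0 < e ->
  exists2 r0, 0 < r0 < 1 & forall r, 0 < r <= r0 -> sphere_max r < wlim + e.
Proof.
move=> e0; have [_ [r0 r001 <-] lt0] := inf_adherent e0 wlim_has_inf.
exists r0 => // r /andP[r0' rr0]; apply: le_lt_trans lt0.
by apply: sphere_max_homo => //; case/andP: r001.
Qed.

(** Comparison with the cone of vertex 0: its slope reaches [sphere_max rho] on the outer sphere,
    and w < [wlim] + e on a small inner one. The added e also keeps the constant term positive when
    [wlim] = 0. *)
Lemma w_le_wlim rho x : 0 < rho < 1 -> 0 < enorm x <= rho ->
  w x <= wlim + sphere_max rho / rho `^ kap * enorm x `^ kap.
Proof.
move=> rho01 /andP[x0 xrho]; have /andP[rho0 rho1] := rho01.
apply/ler_addgt0Pr => e e0.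
have [r0 /andP[r00 r01] r0P] := wlim_near e0.
pose r := Num.min r0 (enorm x).
have rp : 0 < r by rewrite lt_min r00.
have rr0 : r <= r0 by rewrite ge_min lexx.
have rx : r <= enorm x by rewrite ge_min lexx orbT.
have Mrho := sphere_max_gt0 rho01.
set b := sphere_max rho / _; have b0 : 0 <= b by rewrite divr_ge0 ?powR_ge0 ?ltW.
have sub := annulus0_Omega rp rho1.
have -> : wlim + b * enorm x `^ kap + e = (wlim + e) + b * enorm (x - 0) `^ kap.
  by rewrite subr0 addrAC.
apply: (@CC (annulus 0 r rho)) => //.
- exact: annulus_compact.
- exact: annulus_center.
- by move=> y /sub/OmegaE/andP[_ y1]; rewrite subr0; lra.
- by rewrite ltr_wpDl ?wlim_ge0.
- move=> y Dy; have Oy := sub _ Dy.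
  case: (annulus_cases Dy) => yE; [left|left|by right].
  + apply: (@le_trans _ _ (wlim + e)); last by rewrite lerDl mulr_ge0 ?powR_ge0.
    rewrite subr0 in yE; apply: le_trans (ltW (r0P r _)); last by rewrite rp.
    by apply: sphere_max_ge => //; rewrite rp (le_lt_trans rr0).
  + rewrite yE divfK ?gt_eqF ?powR_gt0//; rewrite subr0 in yE.
    apply: (@le_trans _ _ (sphere_max rho)); first exact: sphere_max_ge.
    by rewrite lerDr addr_ge0 ?wlim_ge0 ?ltW.
- by rewrite /annulus/= subr0 rx.
Qed.

(** Comparison with the cone of vertex y, after removing a small ball around y on whose boundary
    upper semicontinuity gives w < w(y) + e; then e tends to 0. *)
Lemma w_le_vertex y r b x : 0 < r < enorm y -> enorm y + r < 1 -> 0 <= b ->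
  (forall p, enorm (p - y) = r -> w p <= w y + b * r `^ kap) ->
  enorm (x - y) <= r -> w x <= w y + b * enorm (x - y) `^ kap.
Proof.
move=> /andP[r0 ry] yr1 b0 bd xr.
have [->|xy] := eqVneq x y.
  by rewrite subrr enorm0 powR0 ?mulr0 ?addr0// gt_eqF.
have y1 : enorm y < 1 by lra.
have Oy : Omega y by apply/OmegaE; rewrite y1 andbT (lt_trans r0).
apply/ler_addgt0Pr => e e0.
have /nbhs_enorm[d d0 dP] : \forall z \near y, w z < w y + e.
  by apply: wusc => //; rewrite ltrDl.
pose r1 := Num.min (d / 2) (enorm (x - y)).
have r10 : 0 < r1 by rewrite lt_min divr_gt0// enorm_gt0 subr_eq0.
have r1d : r1 < d by rewrite (@le_lt_trans _ _ (d / 2)) ?ge_min ?lexx//; lra.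
have r1x : r1 <= enorm (x - y) by rewrite ge_min lexx orbT.
have sub : annulus y r1 r `<=` Omega.
  move=> z /andP[_ zr]; apply/OmegaE.
  have h1 := ler_enorm_dist z y; have h2 := ler_enorm_dist y z.
  rewrite (enorm_distC y z) in h2; apply/andP; split; lra.
rewrite addrAC; apply: (@CC (annulus y r1 r)) => //.
- exact: annulus_compact.
- exact: annulus_center.
- by move=> z /andP[_ zr]; lra.
- by rewrite addr_gt0// wpos.
- move=> z Dz; case: (annulus_cases Dz) => zE; [left|left|by right].
  + apply: (@le_trans _ _ (w y + e)); last by rewrite lerDl mulr_ge0 ?powR_ge0.
    by apply: ltW; apply: dP; rewrite zE.
  + rewrite zE addrAC; apply: le_trans (bd _ zE) _.
    by rewrite lerDl ltW.
- by rewrite /annulus/= r1x.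
Qed.

(** In [chain_step] the point x lies within 2/3 of the radius 3/4 |z| at which the cone is fixed;
    theta is the resulting fraction of its rise. *)
Definition theta : R := (2 / 3) `^ kap.

Lemma theta_bounds : 0 < theta < 1.
Proof.
have t0 : (0 : R) < 2 / 3 by lra.
have t1 : (2 / 3 : R) < 1 by lra.
apply/andP; split; first exact: powR_gt0.
have <- : 1 `^ kap = 1 :> R by rewrite powR1.
by apply: gt0_ltr_powR => //; rewrite nnegrE ltW.
Qed.

Lemma powR_scale_le (c x : R) : 1 <= c -> 0 <= x -> (c * x) `^ kap <= c * x `^ kap.
Proof.
move=> c1 x0; rewrite powRM//; last by lra.
by rewrite ler_wpM2r ?powR_ge0// ler1_powR.
Qed.

Lemma powR_mono (x y : R) : 0 <= x -> x <= y -> x `^ kap <= y `^ kap.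
Proof.
by move=> x0 xy; apply: (ge0_ler_powR (ltW kap0)); rewrite ?nnegrE ?(le_trans x0 xy).
Qed.

(** * Lower bound on spheres by a chain of Hölder estimates *)

Section Chain.
Variables (rho r A : R).
Hypotheses (rho01 : 0 < rho < 1) (r0 : 0 < r) (rrho : 7 / 4 * r <= rho)
  (AE : A = sphere_max rho / rho `^ kap).

Lemma A_gt0 : 0 < A.
Proof.
have /andP[rho0 _] := rho01.
by rewrite AE; apply: divr_gt0; [exact: sphere_max_gt0|exact: powR_gt0].
Qed.

(* If wlim - w <= B A r^kap at some point, the vertex comparison gives the same bound
   with deficit_step B instead of B at the points reached by one step of the chain. *)
Definition deficit_step (B : R) := (B + 2) / (1 - theta).

(** With T bounding w around z, the cone with vertex z gives w(x) <= w(z) + theta (T - w(z)); solved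
    for w(z), a lower bound at x becomes one at z. *)
Lemma chain_step x z B : 0 < enorm z <= r -> enorm (x - z) <= enorm z / 2 -> 0 <= B ->
  wlim - w x <= B * (A * r `^ kap) -> wlim - w z <= deficit_step B * (A * r `^ kap).
Proof.
move=> /andP[z0 zr] xz B0 defx; have /andP[rho0 rho1] := rho01.
have /andP[th0 th1] := theta_bounds; have A0 := A_gt0.
have P0 : 0 < A * r `^ kap by rewrite mulr_gt0// powR_gt0.
pose s := 3 / 4 * enorm z; have s0 : 0 < s by rewrite /s; lra.
(* Bounds w on the sphere of radius s around z, where |p| <= 7/4 |z| <= 7/4 r <= rho; the factor 2
   covers (7/4)^kap. *)
pose T := wlim + 2 * (A * r `^ kap).
have Tle p : 0 < enorm p <= 7 / 4 * r -> w p <= T.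
  move=> /andP[p0 pr]; have prho : 0 < enorm p <= rho by rewrite p0 (le_trans pr).
  apply: le_trans (w_le_wlim rho01 prho) _; rewrite -AE lerD2l mulrCA ler_wpM2l ?(ltW A0)//.
  apply: le_trans (powR_mono (ltW p0) pr) _.
  apply: le_trans (powR_scale_le _ (ltW r0)) _; first lra.
  by rewrite ler_wpM2r ?powR_ge0//; lra.
have wzT : w z <= T by apply: Tle; rewrite z0/=; lra.
have sk0 : 0 < s `^ kap by rewrite powR_gt0.
have bd p : enorm (p - z) = s -> w p <= w z + (T - w z) / s `^ kap * s `^ kap.
  move=> pz; rewrite divfK ?gt_eqF// addrC subrK; apply: Tle.
  have h1 := ler_enorm_dist p z; have h2 := ler_enorm_dist z p.
  by rewrite (enorm_distC z p) in h2; move: pz; rewrite /s => pz; apply/andP; split; lra.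
have := @w_le_vertex z s ((T - w z) / s `^ kap) x _ _ _ bd _.
have ss : 0 < s < enorm z by rewrite s0/= /s; lra.
have zs1 : enorm z + s < 1.
  by apply: le_lt_trans rho1; apply: le_trans rrho; rewrite /s; lra.
have T0 : 0 <= (T - w z) / s `^ kap by rewrite divr_ge0 ?subr_ge0// ltW.
have xzs : enorm (x - z) <= s by rewrite /s; lra.
move=> /(_ ss zs1 T0 xzs) wx.
have xle : (T - w z) / s `^ kap * enorm (x - z) `^ kap <= (T - w z) * theta.
  rewrite -mulrA ler_wpM2l ?subr_ge0// mulrC ler_pdivrMr// /theta -powRM; last by lra.
    apply: powR_mono; first exact: enorm_ge0.
    by rewrite /s; lra.
  lra.
have wx2 := le_trans wx (lerD (lexx _) xle).
rewrite /deficit_step mulrAC ler_pdivlMr ?subr_gt0//.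
move: defx wx2; rewrite /T; move: (A * _) P0 => P P0; nra.
Qed.

(** Five equal steps along the chord. An angle of at most pi / 2 keeps |p|^2 >= r^2 / 2, and a step
    has squared length at most 2 r^2 / 25, so it is no longer than |p| / 2. *)
Lemma chain_right_angle x y B : enorm x = r -> enorm y = r -> 0 <= dot x y -> 0 <= B ->
  wlim - w x <= B * (A * r `^ kap) ->
  wlim - w y <= iter 5 deficit_step B * (A * r `^ kap).
Proof.
move=> xr yr xy B0 defx; have /andP[th0 th1] := theta_bounds.
have r2 : 0 < r ^+ 2 by rewrite exprn_gt0.
have iter_ge0 j : 0 <= iter j deficit_step B.
  elim: j => [//|j IH] /=; apply: divr_ge0; last by rewrite subr_ge0 ltW.
    exact: addr_ge0.
pose p (j : nat) := x + (j%:R / 5) *: (y - x).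
have pp j : p j.+1 - p j = 5^-1 *: (y - x).
  rewrite /p opprD addrACA subrr add0r -scalerBl; congr (_ *: _).
  by rewrite -natr1; field.
have xx : dot x x = r ^+ 2 by rewrite -enorm_sqr xr.
have yy : dot y y = r ^+ 2 by rewrite -enorm_sqr yr.
have xyr : dot x y <= r ^+ 2 by rewrite expr2 -{1}xr -yr dot_le_enorm.
have dyx : dot (y - x) (y - x) = 2 * r ^+ 2 - 2 * dot x y.
  by rewrite dot_sqrD dotNN dotNr xx yy (dotC y); ring.
have dxyx : dot x (y - x) = dot x y - r ^+ 2 by rewrite dotDr dotNr xx.
have pn j : (j <= 5)%N -> r ^+ 2 / 2 <= enorm (p j) ^+ 2 <= r ^+ 2.
  move=> j5; rewrite enorm_sqr /p dot_sqrD !(dotZl, dotZr) dyx dxyx xx.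
  have : 0 <= (j%:R / 5 : R) <= 1.
    by rewrite divr_ge0//= ler_pdivrMr// mul1r ler_nat.
  move: (j%:R / 5) => t /andP[t0 t1].
  have -> : r ^+ 2 + 2 * (t * (dot x y - r ^+ 2)) + t * (t * (2 * r ^+ 2 - 2 * dot x y))
      = r ^+ 2 - 2 * (t * (1 - t)) * (r ^+ 2 - dot x y) by ring.
  have q0 : 0 <= r ^+ 2 - dot x y by rewrite subr_ge0.
  have q1 : r ^+ 2 - dot x y <= r ^+ 2 by rewrite gerBl.
  have t2 : 0 <= t * (1 - t) by rewrite mulr_ge0 ?subr_ge0.
  have t3 : t * (1 - t) <= 4^-1 by have := sqr_ge0 (2 * t - 1); nra.
  move: (r ^+ 2 - _) (t * (1 - t)) q0 q1 t2 t3 => q v q0 q1 v0 v1.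
  apply/andP; split; nra.
have main j : (j <= 5)%N -> wlim - w (p j) <= iter j deficit_step B * (A * r `^ kap).
  elim: j => [_|j IH j5]; first by rewrite /p mul0r scale0r addr0.
  have /andP[p1 p2] := pn _ j5.
  have pr : enorm (p j.+1) <= r.
    by rewrite -(@ler_pXn2r _ 2)// nnegrE ?enorm_ge0// ltW.
  have pz : 0 < enorm (p j.+1).
    rewrite lt_neqAle enorm_ge0 andbT eq_sym; apply/eqP => e.
    by move: p1; rewrite e expr0n/=; lra.
  have pz' : 0 < enorm (p j.+1) <= r by rewrite pz.
  have pd : enorm (p j - p j.+1) <= enorm (p j.+1) / 2.
    rewrite enorm_distC pp -(@ler_pXn2r _ 2)// ?nnegrE ?enorm_ge0//; last first.
      by rewrite divr_ge0 ?enorm_ge0.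
    rewrite enormZ ger0_norm ?invr_ge0// !exprMn enorm_sqr dyx; lra.
  exact: (chain_step pz' pd (iter_ge0 j) (IH (ltnW j5))).
by have := main 5%N isT; rewrite /p divff// scale1r [x + _]addrC subrK.
Qed.

(* Two points of a sphere are joined through a third one which makes angles of at most
   pi / 2 with both, so that the chords stay away from 0. *)
Lemma orthogonal_exists (x : 'rV[R]_n) : exists2 e : 'rV[R]_n, e != 0 & dot x e = 0.
Proof.
have n0 : (0 < n)%N by rewrite (leq_trans _ n2).
have n1 : (1 < n)%N by rewrite (leq_trans _ n2).
pose i := Ordinal n0; pose j := Ordinal n1.
have de (a : 'I_n) : delta_mx 0 a != 0 :> 'rV[R]_n.
  apply/eqP => /rowP/(_ a); rewrite !mxE !eqxx => /eqP; by rewrite oner_eq0.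
have [xi0|xi0] := eqVneq (x 0 i) 0.
  by exists (delta_mx 0 i) => //; rewrite dot_delta.
exists (x 0 j *: delta_mx 0 i - x 0 i *: delta_mx 0 j); last first.
  by rewrite dotDr dotNr !dotZr !dot_delta mulrC subrr.
apply/eqP => /rowP/(_ j); rewrite !mxE !eqxx/= => /eqP.
by rewrite mulr0 mulr1 sub0r oppr_eq0 (negbTE xi0).
Qed.

(** The chain starts at the maximum point of w on the sphere, where [wlim] - w is not positive, and
    reaches y by two chords of five steps each. *)
Lemma chain_sphere y : enorm y = r -> wlim - w y <= iter 10 deficit_step 0 * (A * r `^ kap).
Proof.
move=> yr; have /andP[rho0 rho1] := rho01; have /andP[th0 th1] := theta_bounds.
have r01 : 0 < r < 1.
  by rewrite r0/=; apply: le_lt_trans rho1; apply: le_trans rrho; move: r0; lra.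
have [xr _] := sphere_argmaxP r01; set x := sphere_argmax r in xr.
have [e e0 xe] := orthogonal_exists x.
have en : 0 < enorm e by rewrite enorm_gt0.
(* The sign makes the vector orthogonal to x form an angle of at most pi / 2 with y as well. *)
pose sg : R := if 0 <= dot e y then 1 else -1.
have sg1 : `|sg| = 1 by rewrite /sg; case: ifP; rewrite ?normrN normr1.
have sgy : 0 <= sg * dot e y.
  rewrite /sg; case: ifP => [|/negbT]; first by rewrite mul1r.
  by rewrite -ltNge mulN1r oppr_ge0; exact: ltW.
pose z := (r / enorm e) *: (sg *: e).
have zr : enorm z = r.
  rewrite /z !enormZ normrM normfV (gtr0_norm r0) (gtr0_norm en) sg1.
  by rewrite mul1r divfK// gt_eqF.
have xz : 0 <= dot x z by rewrite /z !dotZr xe !mulr0.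
have zy : 0 <= dot z y by rewrite /z !dotZl; apply: mulr_ge0 sgy; apply: divr_ge0; exact: ltW.
have P0 : 0 < A * r `^ kap by rewrite mulr_gt0 ?A_gt0// powR_gt0.
have d0 : wlim - w x <= 0 * (A * r `^ kap).
  by rewrite mul0r subr_le0; exact: wlim_le.
have d1 := chain_right_angle xr zr xz (lexx 0) d0.
have i0 : 0 <= iter 5 deficit_step 0.
  elim: (5%N) => [//|j IH] /=; apply: divr_ge0; last by rewrite subr_ge0 ltW.
  exact: addr_ge0.
by have := chain_right_angle zr yr zy i0 d1; rewrite -iterD.
Qed.

End Chain.

(** Ten chain steps from deficit 0; the added 2 handles points too close to the outer sphere for a
    chain. *)
Definition chain_const := iter 10 deficit_step 0 + 2.

Lemma chain_const_ge2 : 2 <= chain_const.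
Proof.
rewrite /chain_const lerDr; elim: (10%N) => [//|j IH] /=.
have /andP[th0 th1] := theta_bounds; apply: divr_ge0; last by rewrite subr_ge0 ltW.
exact: addr_ge0.
Qed.

(** The chain needs 7/4 |y| <= rho. Otherwise 2 A |y|^kap is already at least [sphere_max rho],
    hence at least [wlim], and w > 0 suffices. *)
Lemma w_ge_wlim rho y : 0 < rho < 1 -> 0 < enorm y <= rho ->
  wlim - chain_const * (sphere_max rho / rho `^ kap * enorm y `^ kap) <= w y.
Proof.
move=> rho01 /andP[y0 yrho]; have /andP[rho0 rho1] := rho01.
have A0 := A_gt0 rho01 erefl; set A := _ / _ in A0 *.
have P0 : 0 < A * enorm y `^ kap by rewrite mulr_gt0// powR_gt0.
have [yr|yr] := leP (7 / 4 * enorm y) rho.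
  have := chain_sphere rho01 y0 yr erefl erefl; rewrite -/A.
  by rewrite /chain_const; move: (iter _ _ _) (A * _) P0 => B P; lra.
have Oy : Omega y by apply/OmegaE; rewrite y0 (le_lt_trans yrho).
apply: le_trans (ltW (wpos Oy)); rewrite subr_le0.
apply: (@le_trans _ _ (2 * (A * enorm y `^ kap))); last first.
  by rewrite ler_wpM2r ?(ltW P0)// chain_const_ge2.
apply: le_trans (wlim_le rho01) _.
have -> : sphere_max rho = A * rho `^ kap by rewrite /A divfK// gt_eqF// powR_gt0.
rewrite mulrCA ler_wpM2l ?(ltW A0)//.
apply: le_trans (powR_mono (ltW rho0) (ltW yr)) _.
apply: le_trans (powR_scale_le _ (ltW y0)) _; first lra.
by rewrite ler_wpM2r ?powR_ge0//; lra.
Qed.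

(** * Hölder continuity of [w] extended across the origin *)

Definition w_ext x := if x == 0 then wlim else w x.

(** [th] is the ratio |x - y| / |y| that separates near from far pairs below. *)
Definition holder_const (th : R) := (2 + chain_const) / th `^ kap.

(** Far pairs are compared through the two-sided bounds around [wlim], since th |x| and th |y| are
    then at most 2 |x - y|. For near pairs the cone with vertex y on the ball of radius th |y|
    applies; on its boundary w exceeds w(y) by at most (2 + [chain_const]) A |y|^kap, and the slope
    is normalized to reach this. *)
Lemma w_ext_holder_le rho rho' th x y : 0 < rho' < 1 -> 0 < th <= 2^-1 ->
  (1 + th) * rho <= rho' -> enorm x <= rho -> enorm y <= rho ->
  w_ext x <= w_ext y + holder_const th * (sphere_max rho' / rho' `^ kap) * enorm (x - y) `^ kap.
Proof.
move=> rho01 /andP[th0 th1] rr xr yr; have /andP[rho0 rho1] := rho01.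
have A0 := A_gt0 rho01 erefl; set A := _ / rho' `^ _ in A0 *.
have B2 := chain_const_ge2; have thk : 0 < th `^ kap by rewrite powR_gt0.
have rho_ge0 : 0 <= rho := le_trans (enorm_ge0 x) xr.
have rhole : rho <= rho' by apply: le_trans rr; rewrite mulrDl mul1r lerDl mulr_ge0// ltW.
have H0 : 0 < holder_const th by rewrite divr_gt0//; lra.
have upper z : enorm z <= rho' -> w_ext z <= wlim + A * enorm z `^ kap.
  move=> zr; rewrite /w_ext; case: eqVneq => [->|z0].
    by rewrite lerDl mulr_ge0 ?powR_ge0 ?ltW.
  by apply: w_le_wlim => //; rewrite enorm_gt0 z0.
have lower z : enorm z <= rho' -> wlim - chain_const * (A * enorm z `^ kap) <= w_ext z.
  move=> zr; rewrite /w_ext; case: eqVneq => [->|z0].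
    rewrite gerBl; apply: mulr_ge0; first lra.
    by apply: mulr_ge0; [exact: ltW|exact: powR_ge0].
  by apply: w_ge_wlim => //; rewrite enorm_gt0 z0.
have xr' := le_trans xr rhole; have yr' := le_trans yr rhole.
have [->|xy] := eqVneq x y.
  by rewrite lerDl; apply: mulr_ge0; [apply: mulr_ge0; exact: ltW|exact: powR_ge0].
have [far|near_] := ltP (th * enorm y) (enorm (x - y)).
  have d0 := enorm_ge0 (x - y); have x0 := enorm_ge0 x; have y0 := enorm_ge0 y.
  have h1 := ler_enorm_dist x y.
  have hx : th `^ kap * enorm x `^ kap <= 2 * enorm (x - y) `^ kap.
    rewrite -powRM// ?(ltW th0)//; apply: le_trans (powR_scale_le _ d0); last by lra.
    by apply: powR_mono; [rewrite mulr_ge0// ltW|nra].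
  have hy : th `^ kap * enorm y `^ kap <= enorm (x - y) `^ kap.
    rewrite -powRM// ?(ltW th0)//.
    by apply: powR_mono; [rewrite mulr_ge0// ltW|exact: ltW].
  apply: le_trans (upper x xr') _; have ly := lower y yr'.
  suff : A * enorm x `^ kap + chain_const * (A * enorm y `^ kap)
     <= holder_const th * A * enorm (x - y) `^ kap by lra.
  rewrite /holder_const.
  move: (enorm (x - y) `^ kap) (enorm x `^ kap) (enorm y `^ kap) (th `^ kap) thk hx hy
    => D X Y T T0 hx hy.
  have -> : (2 + chain_const) / T * A * D = ((2 + chain_const) * A * D) / T.
    by field; rewrite gt_eqF.
  rewrite ler_pdivlMr//.
  have e1 : A * (T * X) <= A * (2 * D) by rewrite ler_wpM2l// ltW.
  have e2 : chain_const * A * (T * Y) <= chain_const * A * D.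
    by rewrite ler_wpM2l// mulr_ge0 ?(ltW A0)//; lra.
  lra.
have y0 : y != 0.
  apply/eqP => ye; move: near_; rewrite ye enorm0 mulr0 subr0 leNgt.
  by rewrite enorm_gt0 -ye xy.
have ye : 0 < enorm y by rewrite enorm_gt0.
have x0 : x != 0.
  apply/eqP => xe; move: near_; rewrite xe sub0r enormN; nra.
rewrite /w_ext (negbTE x0) (negbTE y0).
have r0 : 0 < th * enorm y < enorm y by rewrite mulr_gt0//=; nra.
have yr1 : enorm y + th * enorm y <= rho'.
  by apply: le_trans rr; rewrite mulrDl mul1r; apply: lerD => //; rewrite ler_pM2l.
apply: (w_le_vertex r0 _ _ _ near_).
- exact: le_lt_trans rho1.
- by rewrite mulr_ge0// ltW.
- move=> p pE.
  have h1 := ler_enorm_dist p y; have h2 := ler_enorm_dist y p.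
  rewrite (enorm_distC y p) in h2.
  have p0 : 0 < enorm p by have /andP[_] := r0; lra.
  have p2 : enorm p <= 2 * enorm y by have /andP[_] := r0; lra.
  have prho : enorm p <= rho' by lra.
  have pz : p != 0 by rewrite -enorm_gt0.
  have := upper p prho; rewrite /w_ext (negbTE pz) => up.
  have := lower y yr'; rewrite /w_ext (negbTE y0) => lo.
  have pk : enorm p `^ kap <= 2 * enorm y `^ kap.
    apply: le_trans (powR_mono (ltW p0) p2) _.
    by apply: powR_scale_le; [lra|exact: ltW].
  have -> : holder_const th * A * (th * enorm y) `^ kap = (2 + chain_const) * (A * enorm y `^ kap).
    rewrite powRM ?(ltW th0) ?(ltW ye)// /holder_const; move: (enorm y `^ kap) => Y.
    by field; rewrite gt_eqF.
  have : A * enorm p `^ kap <= A * (2 * enorm y `^ kap) by rewrite ler_wpM2l// ltW.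
  lra.
Qed.

(** * The case [wlim] = 0: [u] behaves like a multiple of the fundamental solution *)

Section ZeroLimit.
Hypothesis wl0 : wlim = 0.

Definition sphere_ratio r := sphere_max r / r `^ kap.

Lemma sphere_ratio_gt0 r : 0 < r < 1 -> 0 < sphere_ratio r.
Proof.
move=> r01; have /andP[r0 _] := r01.
by apply: divr_gt0; [exact: sphere_max_gt0|exact: powR_gt0].
Qed.

Lemma sphere_maxE r : 0 < r -> sphere_max r = sphere_ratio r * r `^ kap.
Proof. by move=> r0; rewrite divfK// gt_eqF// powR_gt0. Qed.

Lemma w_le_sphere_ratio rho x : 0 < rho < 1 -> 0 < enorm x <= rho -> w x <= sphere_ratio rho * enorm x `^ kap.
Proof. by move=> rho01 xr; have := w_le_wlim rho01 xr; rewrite wl0 add0r. Qed.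

(** Evaluate the cone bound of the larger radius at the maximum point on the smaller sphere. *)
Lemma sphere_ratio_homo r s : 0 < r -> r <= s -> s < 1 -> sphere_ratio r <= sphere_ratio s.
Proof.
move=> r0 rs s1; have r01 : 0 < r < 1 by rewrite r0 (le_lt_trans rs).
have s01 : 0 < s < 1 by rewrite (lt_le_trans r0).
have xr := (sphere_argmaxP r01).1.
rewrite ler_pdivrMr ?powR_gt0// -{2}xr; apply: w_le_sphere_ratio => //.
by rewrite xr r0.
Qed.

(** Because k kap = N - 2, the power -k turns a cone with vertex 0 into a multiple of the
    fundamental solution. *)
Lemma powR_scale c r : 0 < c -> 0 < r -> (c * r `^ kap) `^ (- k) = c `^ (- k) * r `^ (2 - N).
Proof.
move=> c0 r0; rewrite powRM ?powR_ge0 ?(ltW c0)//; congr (_ * _).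
by rewrite -powRrM mulrN mulrC kE opprB.
Qed.

Let N2 : 0 < N - 2.
Proof. exact: natr_gt2. Qed.

Lemma ltr_fund (r s : R) : 0 < r -> 0 < s -> (r `^ (2 - N) < s `^ (2 - N)) = (s < r).
Proof. by move=> r0 s0; rewrite -(opprB N 2) ltr_powRN. Qed.

Lemma ler_fund (r s : R) : 0 < r -> 0 < s -> (r `^ (2 - N) <= s `^ (2 - N)) = (s <= r).
Proof. by move=> r0 s0; rewrite -(opprB N 2) ler_powRN. Qed.

Lemma u_ge_sphere_ratio rho x : 0 < rho < 1 -> 0 < enorm x <= rho ->
  sphere_ratio rho `^ (- k) * enorm x `^ (2 - N) <= u x.
Proof.
move=> rho01 xr; have /andP[x0 xle] := xr; have /andP[_ rho1] := rho01.
have Ox : Omega x by apply/OmegaE; rewrite x0 (le_lt_trans xle).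
rewrite -powR_scale ?sphere_ratio_gt0// (wK Ox) ler_powRN//.
- exact: w_le_sphere_ratio.
- by rewrite mulr_gt0 ?sphere_ratio_gt0 ?powR_gt0.
- exact: wpos.
Qed.

(** With c the power -k of [sphere_ratio r], u dominates c (|x|^(2 - N) - (1/2)^(2 - N)) between the
    radii r and 1/2. Its value at a fixed point with |x| = 1/4 bounds c from above independently of
    r, hence the ratio from below. Radii above 1/8 follow by monotonicity. *)
Lemma sphere_ratio_lower : exists2 c0, 0 < c0 & forall r, 0 < r < 1 -> c0 <= sphere_ratio r.
Proof.
have n0 : (0 < n)%N by rewrite (leq_trans _ n2).
have q0 : (0 : R) < 4^-1 by lra.
have [x xE] := @sphere_neq0 R n _ n0 (ltW q0).
have Ox : Omega x by apply/OmegaE; rewrite xE; apply/andP; split; lra.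
pose g : R := 4^-1 `^ (2 - N) - 2^-1 `^ (2 - N).
have g0 : 0 < g by rewrite subr_gt0 ltr_fund; lra.
pose C0 := u x / g; have C00 : 0 < C0 by rewrite divr_gt0// upos.
have h2 : (2^-1 : R) < 1 by lra.
have small r : 0 < r <= 8^-1 -> C0 `^ (- k^-1) <= sphere_ratio r.
  move=> /andP[r0 r8]; have r01 : 0 < r < 1 by rewrite r0/=; lra.
  have ck0 := sphere_ratio_gt0 r01.
  rewrite -(@ler_powRN _ k) ?powR_gt0// powRNK ?(ltW C00)// ler_pdivlMr//.
  set c := sphere_ratio r `^ (- k); have c0 : 0 < c by rewrite powR_gt0.
  have := @SH (annulus 0 r (2^-1)) 0 c 0 (- (c * 2^-1 `^ (2 - N)))
    (@annulus_compact _ _ _ _ _) (annulus0_Omega r0 h2).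
  have nD0 := @annulus_center _ _ (0 : 'rV[R]_n) r 2^-1 r0.
  move=> /(_ nD0 nD0).
  have Dx : annulus 0 r 2^-1 x by rewrite /annulus/= subr0 xE; apply/andP; split; lra.
  move=> h; have {h} := h _ x Dx; rewrite mul0r addr0 xE -mulrBr; apply.
  move=> y Dy; have Oy := annulus0_Omega r0 h2 Dy.
  rewrite mul0r addr0; case: (annulus_cases Dy); rewrite ?subr0 => yE.
  - left; apply: (@le_trans _ _ (c * enorm y `^ (2 - N))).
      by rewrite gerDl oppr_le0 mulr_ge0 ?powR_ge0.
    by apply: u_ge_sphere_ratio => //; rewrite yE r0/=.
  - by left; rewrite yE subrr ltW// upos.
  - by right.
have e0 : (0 : R) < 8^-1 by lra.
exists (C0 `^ (- k^-1)); first exact: powR_gt0.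
move=> r /andP[r0 r1]; have [r8|r8] := leP r 8^-1.
  by apply: small; rewrite r0.
apply: (@le_trans _ _ (sphere_ratio 8^-1)); first by apply: small; rewrite e0/=.
by apply: sphere_ratio_homo => //; exact: ltW.
Qed.

(** By monotonicity also the limit of the ratio at 0, called L in the overview. *)
Definition ratio_inf := inf [set sphere_ratio r | r in [set r : R | 0 < r < 1]].

Lemma ratio_inf_has_inf : has_inf [set sphere_ratio r | r in [set r : R | 0 < r < 1]].
Proof.
split; first by exists (sphere_ratio (2^-1)), (2^-1) => //=; apply/andP; split; lra.
by exists 0 => _ [r r01 <-]; rewrite ltW// sphere_ratio_gt0.
Qed.

Lemma ratio_inf_gt0 : 0 < ratio_inf.
Proof.
have [c0 c00 cP] := sphere_ratio_lower; apply: lt_le_trans c00 _.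
by apply: lb_le_inf; [exact: ratio_inf_has_inf.1|move=> _ [r r01 <-]; exact: cP].
Qed.

Lemma ratio_inf_le r : 0 < r < 1 -> ratio_inf <= sphere_ratio r.
Proof. by move=> r01; apply: ge_inf; [exact: ratio_inf_has_inf.2|exists r]. Qed.

Lemma ratio_inf_near e : 0 < e ->
  exists2 r0, 0 < r0 < 1 & forall r, 0 < r <= r0 -> sphere_ratio r < ratio_inf + e.
Proof.
move=> e0; have [_ [r0 r001 <-] lt0] := inf_adherent e0 ratio_inf_has_inf.
exists r0 => // r /andP[r0' rr0]; apply: le_lt_trans lt0.
by apply: sphere_ratio_homo => //; case/andP: r001.
Qed.

(** Chooses the relative radius [th] of a ball around y: one bound limits the rise of w over the
    ball, the other the variation of |x|^(2 - N) on it. *)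
Lemma small_angle (K1 d c sg : R) : 0 < K1 -> 0 < d -> 0 < c -> 0 < sg ->
  exists th : R, [/\ 0 < th, th <= 4^-1, 2 * K1 * (2 * th) `^ kap <= d &
    c * (1 - th) `^ (2 - N) <= c + sg].
Proof.
move=> K10 d0 c0 sg0.
have cont : (fun t : R => c * t `^ (2 - N)) @ (1 : R) --> c * 1 `^ (2 - N).
  apply: (@cvgM _ _ (nbhs (1 : R)) _ (fun=> c)); first exact: cvg_cst.
  exact: powR_cont.
have /nbhs_ballP[e /= e0 eP] : \forall t \near (1 : R), c * t `^ (2 - N) < c + sg.
  by apply: (cvgr_lt _ cont); rewrite powR1 mulr1 ltrDl.
pose eta := d / (2 * K1); have eta0 : 0 < eta by rewrite divr_gt0// mulr_gt0.
pose t1 := eta `^ kap^-1 / 2; have t10 : 0 < t1 by rewrite divr_gt0// powR_gt0.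
pose th := Num.min (Num.min (e / 2) 4^-1) t1.
have q4 : (0 : R) < 4^-1 by lra.
have th0 : 0 < th by rewrite !lt_min t10 q4 divr_gt0.
have the : th <= e / 2 by rewrite !ge_min lexx.
have th4 : th <= 4^-1 by rewrite !ge_min lexx orbT.
have tht : th <= t1 by rewrite ge_min lexx orbT.
exists th; split => //.
- apply: (@le_trans _ _ (2 * K1 * eta)); last first.
    by rewrite /eta mulrC divfK// mulf_neq0// gt_eqF.
  rewrite ler_pM2l ?mulr_gt0//.
  have -> : eta = (2 * t1) `^ kap.
    by rewrite /t1 mulrC divfK// -powRrM mulVf ?powRr1 ?gt_eqF// ltW.
  by apply: powR_mono; [rewrite mulr_ge0// ltW|rewrite ler_pM2l].
- apply: ltW; apply: eP; rewrite /ball/= opprB addrC subrK gtr0_norm//; lra.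
Qed.

(** The cone with vertex y, fixed by the bound for w at distance |y| / 2, rises by at most (d / 2)
    |y|^kap over the ball of radius th |y|. *)
Lemma w_le_near y d th x : 0 < d < ratio_inf -> 0 < enorm y <= 16^-1 -> 0 < th <= 4^-1 ->
  2 * sphere_ratio 2^-1 * (2 * th) `^ kap <= d / 2 -> w y <= (ratio_inf - d) * enorm y `^ kap ->
  enorm (x - y) <= th * enorm y -> w x <= (ratio_inf - d / 2) * enorm y `^ kap.
Proof.
move=> /andP[d0 dL] /andP[]; set R0 := enorm y => y0 y16 /andP[th0 th4] thK wy xy.
have half01 : 0 < (2^-1 : R) < 1 by apply/andP; split; lra.
have K10 := sphere_ratio_gt0 half01; set K1 := sphere_ratio _ in thK K10.
have h2 : 0 < R0 / 2 < R0 by apply/andP; split; lra.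
have h3 : R0 + R0 / 2 < 1 by lra.
have Rk : 0 < (R0 / 2) `^ kap by rewrite powR_gt0// divr_gt0.
(* At distance |y| / 2 from y the cone rises by 2 K1 |y|^kap, which bounds w there because |p| <= 2
   |y|. *)
pose b := 2 * K1 * R0 `^ kap / (R0 / 2) `^ kap.
have b0 : 0 <= b.
  by apply: divr_ge0; [rewrite mulr_ge0 ?powR_ge0// mulr_ge0// ltW|exact: powR_ge0].
have Oy : Omega y by apply/OmegaE; rewrite -/R0 y0/=; lra.
have bd p : enorm (p - y) = R0 / 2 -> w p <= w y + b * (R0 / 2) `^ kap.
  move=> pE; rewrite /b divfK ?gt_eqF//.
  have p1 := ler_enorm_dist y p; have p2 := ler_enorm_dist p y.
  rewrite (enorm_distC y p) -/R0 pE in p1; rewrite -/R0 pE in p2.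
  have pp0 : 0 < enorm p <= 2^-1 by apply/andP; split; lra.
  apply: le_trans (w_le_sphere_ratio half01 pp0) _; rewrite -/K1.
  have Oy' := wpos Oy; apply: le_trans (_ : 2 * K1 * R0 `^ kap <= _); last by rewrite lerDr ltW.
  rewrite -mulrA mulrCA ler_pM2l//.
  have pR : enorm p <= 2 * R0 by lra.
  have /andP[/ltW p0 _] := pp0.
  apply: le_trans (powR_mono p0 pR) _.
  by apply: powR_scale_le; [lra|exact: ltW].
have xy2 : enorm (x - y) <= R0 / 2.
  by apply: le_trans xy _; rewrite mulrC ler_pM2l//; lra.
apply: le_trans (w_le_vertex h2 h3 b0 bd xy2) _.
have bx : b * enorm (x - y) `^ kap <= d / 2 * R0 `^ kap.
  apply: (@le_trans _ _ (b * ((2 * th) * (R0 / 2)) `^ kap)).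
    rewrite ler_wpM2l//; apply: powR_mono; first exact: enorm_ge0.
    by apply: le_trans xy _; rewrite le_eqVlt; apply/orP; left; apply/eqP; field.
  rewrite powRM; [|by rewrite mulr_ge0// ltW|by rewrite divr_ge0// ltW].
  have -> : b * ((2 * th) `^ kap * (R0 / 2) `^ kap)
    = 2 * K1 * (2 * th) `^ kap * R0 `^ kap by rewrite /b; field; rewrite gt_eqF.
  by rewrite ler_pM2r// powR_gt0.
by apply: le_trans (lerD wy bx) _; rewrite -mulrDl le_eqVlt; apply/orP; left; apply/eqP; field.
Qed.

(* The barrier lives on the ball of radius 3 |y| around y with a small ball around y
   and the origin removed; 0 is negligible because c' - e replaces c'. *)
Lemma sphere_improvement y th c c' sg x : 0 < enorm y < 4^-1 -> 0 < th <= 4^-1 ->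
  0 < c' <= c -> 0 < sg -> c * (1 - th) `^ (2 - N) <= c + sg ->
  (forall z, enorm (z - y) <= th * enorm y -> (c + 2 * sg) * enorm y `^ (2 - N) <= u z) ->
  (forall z, 0 < enorm z <= 4 * enorm y -> c' * enorm z `^ (2 - N) <= u z) ->
  enorm x = enorm y -> th * enorm y < enorm (x - y) ->
  (c' + sg * th^-1 `^ (2 - N) * (2 `^ (2 - N) - 3 `^ (2 - N))) * enorm y `^ (2 - N) <= u x.
Proof.
move=> /andP[]; set R0 := enorm y => y0 y4 /andP[th0 th4] /andP[c'0 c'c] sg0 thc inner outer xE xfar.
have F0 : 0 < R0 `^ (2 - N) by rewrite powR_gt0.
(* Normalized so that the pole at y has the value sg |y|^(2 - N) at distance th |y|. *)
set A := sg * _; have A0 : 0 < A by rewrite mulr_gt0// powR_gt0// invr_gt0.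
have q2 : 0 < 2 * R0 by rewrite mulr_gt0.
have q3 : 0 < 3 * R0 by rewrite mulr_gt0.
have q4 : 4 * R0 < 1 by rewrite mulrC -ltr_pdivlMr// mul1r.
have thR0 : 0 < th * R0 by rewrite mulr_gt0.
have xnear : enorm (x - y) <= 2 * R0.
  by apply: le_trans (ler_enormD _ _) _; rewrite enormN xE -/R0 mulr_natl mulr2n.
have AthR : A * (th * R0) `^ (2 - N) = sg * R0 `^ (2 - N).
  rewrite /A powRM ?(ltW th0) ?(ltW y0)// mulrA -(mulrA sg) -powRM ?invr_ge0 ?(ltW th0)//.
  by rewrite mulVf ?gt_eqF// powR1 mulr1.
have xp := lt_trans thR0 xfar.
have xA : A * (2 * R0) `^ (2 - N) <= A * enorm (x - y) `^ (2 - N).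
  by rewrite (ler_pM2l A0) (ler_fund q2 xp).
suff main : c' * R0 `^ (2 - N) + A * (2 * R0) `^ (2 - N) - A * (3 * R0) `^ (2 - N) <= u x.
  apply: le_trans main; rewrite powRM ?(ltW y0)// (@powRM _ 3) ?(ltW y0)//.
  by rewrite le_eqVlt; apply/orP; left; apply/eqP; ring.
apply/ler_addgt0Pr => e' e'0; pose e := e' / R0 `^ (2 - N).
have e0 : 0 < e by rewrite divr_gt0.
have e'E : e' = e * R0 `^ (2 - N) by rewrite /e divfK// gt_eqF.
have R01 : R0 <= 1 by apply: ltW; apply: lt_trans y4 _; lra.
have R0b : 0 < R0 <= 1 by rewrite y0.
(* On |z| = r the loss e r^(2 - N) outweighs the pole at y, whose term is at most sg |y|^(2 - N)
   outside the small ball. *)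
have [r /andP[rp rR] rbig] := @powR_small_radius (sg * R0 `^ (2 - N) / e) R0 R0b.
pose D := annulus y (th * R0) (3 * R0) `&` annulus 0 r (4 * R0).
have sub0 : annulus 0 r (4 * R0) `<=` Omega := annulus0_Omega rp q4.
have cD : compact D.
  apply: (@subclosed_compact _ _ (annulus 0 r (4 * R0))).
  - apply: closedI; apply: compact_closed; [exact: norm_hausdorff|exact: annulus_compact
      |exact: norm_hausdorff|exact: annulus_compact].
  - exact: annulus_compact.
  - by move=> z [].
have nD0 : ~ D 0 by case=> _; exact: annulus_center.
have nDy : ~ D y by case=> /annulus_center-/(_ thR0).
have le34 t : t <= 2 * R0 -> t <= 3 * R0.
  by move=> h; apply: le_trans h _; rewrite ler_pM2r//; lra.
have Dx : D x.
  split; rewrite /annulus/=; first by rewrite (ltW xfar) le34.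
  by rewrite subr0 xE rR/= ler_peMl ?(ltW y0)//; lra.
have bd z : D z -> (c' - e) * enorm z `^ (2 - N) + A * enorm (z - y) `^ (2 - N) +
    - (A * (3 * R0) `^ (2 - N)) <= u z \/ \forall t \near z, D t.
  move=> [Dz1 Dz0].
  have /andP[z1 z3] := Dz1; have /andP[zr z4] := Dz0; rewrite subr0 in zr z4.
  have z0 : 0 < enorm z by exact: lt_le_trans rp zr.
  have uz : c' * enorm z `^ (2 - N) <= u z by apply: outer; rewrite z0.
  have P3 : 0 < A * (3 * R0) `^ (2 - N) by rewrite mulr_gt0 ?powR_gt0.
  have Pz : 0 < e * enorm z `^ (2 - N) by rewrite mulr_gt0 ?powR_gt0.
  have zy0 : 0 < enorm (z - y) by exact: lt_le_trans thR0 z1.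
  have Pd : A * enorm (z - y) `^ (2 - N) <= sg * R0 `^ (2 - N).
    by rewrite -AthR (ler_pM2l A0) (ler_fund zy0 thR0).
  have triy : R0 <= enorm (z - y) + enorm z.
    by have := ler_enorm_dist y z; rewrite (enorm_distC y z).
  rewrite mulrBl.
  (* On |z - y| = th |y| one has |z| >= (1 - th) |y|, so the first term is at most (c + sg) |y|^(2 -
     N) and the pole fits into the surplus of [inner]. On |z - y| = 3 |y| the pole term cancels
     against the constant. *)
  case: (annulus_cases Dz1) => zE.
  - left; have iz := inner z; rewrite zE lexx in iz; have {}iz := iz isT.
    rewrite zE AthR.
    have hc : c' * enorm z `^ (2 - N) <= (c + sg) * R0 `^ (2 - N).
      have th1 : 0 < 1 - th by rewrite subr_gt0 (le_lt_trans th4)// invf_lt1 ?ltr1n.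
      apply: (@le_trans _ _ (c * (1 - th) `^ (2 - N) * R0 `^ (2 - N))); last by rewrite ler_pM2r.
      rewrite -mulrA -powRM ?(ltW y0) ?(ltW th1)//.
      have q : 0 < (1 - th) * R0 by rewrite mulr_gt0.
      apply: ler_pM; [exact: ltW|exact: powR_ge0|exact: c'c|].
      by rewrite (ler_fund z0 q) mulrBl mul1r lerBlDl -zE.
    exact: le_barrier1 iz hc P3 Pz.
  - by left; rewrite zE; exact: le_barrier3 uz Pz.
  case: (annulus_cases Dz0); rewrite ?subr0 => zE0.
  - left; have ez : sg * R0 `^ (2 - N) <= e * enorm z `^ (2 - N).
      by rewrite zE0 (mulrC e) -ler_pdivrMr.
    exact: le_barrier2 uz P3 (le_trans Pd ez).
  (* |z| = 4 |y| together with |z - y| <= 3 |y| forces |z - y| = 3 |y|. *)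
  - left; have a1 := ler_enorm_dist z y; rewrite -/R0 zE0 in a1.
    by rewrite (le_barrier4 z3 a1); exact: le_barrier3 uz Pz.
  - by right; near=> t; split; near: t.
have h := @SH D y (c' - e) A (- (A * (3 * R0) `^ (2 - N))) cD (fun z Dz => sub0 z Dz.2) nD0 nDy bd x Dx.
by rewrite xE -/R0 in h; rewrite e'E; exact: le_barrier5 h xA.
Unshelve. all: by end_near. Qed.

(** Otherwise u is large on a small ball around y, and [sphere_improvement] lifts u above c |y|^(2 -
    N) on the rest of the sphere |x| = |y|. The maximum point of w on that sphere contradicts both,
    since w there is at least [ratio_inf] |y|^kap. *)
Lemma ratio_lower d : 0 < d < ratio_inf -> exists2 r0, 0 < r0 < 1 &
  forall y, 0 < enorm y <= r0 -> (ratio_inf - d) * enorm y `^ kap < w y.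
Proof.
move=> dL'; have /andP[d0 dL] := dL'; have L0 := ratio_inf_gt0.
pose c := ratio_inf `^ (- k); have c0 : 0 < c by rewrite powR_gt0.
have Lh0 : 0 < ratio_inf - d / 2 by lra.
(* The dip of w near y raises the coefficient of |y|^(2 - N) in the lower bound for u from c to c +
   2 sg. Half of the surplus pays for the variation of |z|^(2 - N), the other half feeds the pole at
   y. *)
pose sg := ((ratio_inf - d / 2) `^ (- k) - c) / 2.
have sg0 : 0 < sg by rewrite divr_gt0// subr_gt0 ltr_powRN//; lra.
have sgE : c + 2 * sg = (ratio_inf - d / 2) `^ (- k) by rewrite /sg; field.
have half01 : 0 < (2^-1 : R) < 1 by apply/andP; split; lra.
have d2 : 0 < d / 2 by rewrite divr_gt0.
have [th [th0 th4 thK thc]] := small_angle (sphere_ratio_gt0 half01) d2 c0 sg0.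
pose A' := sg * th^-1 `^ (2 - N) * (2 `^ (2 - N) - 3 `^ (2 - N)).
have A'0 : 0 < A'.
  apply: mulr_gt0; first by rewrite mulr_gt0// powR_gt0// invr_gt0.
  by rewrite subr_gt0 ltr_fund//; lra.
(* For small radii the ratio is so close to its infimum that replacing c by the value c' at radius 4
   |y| loses less than the gain [A']. *)
have [r1 r101 r1P] : exists2 r1, 0 < r1 < 1 & forall r, 0 < r <= r1 -> c - A' < sphere_ratio r `^ (- k).
  have /nbhs_ballP[e /= e0 eP] : \forall t \near ratio_inf, c - A' < t `^ (- k).
    by apply: (cvgr_gt _ (@powR_cont _ (- k) _ L0)); rewrite -/c gtrBl.
  have [r1 r101 r1P] := ratio_inf_near e0; exists r1 => // r rr1.
  have r01 : 0 < r < 1.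
    by have /andP[-> h] := rr1; rewrite (le_lt_trans h)//; case/andP: r101.
  apply: eP; rewrite /ball/= distrC ger0_norm ?subr_ge0 ?ratio_inf_le//.
  by rewrite ltrBlDl; exact: r1P.
have /andP[r10 r11] := r101.
exists (Num.min (r1 / 4) 16^-1).
  have q1 : (0 : R) < 16^-1 by lra.
  have q2 : (16^-1 : R) < 1 by lra.
  by rewrite lt_min divr_gt0// q1 gt_min q2 orbT.
move=> y /andP[y0]; rewrite le_min => /andP[yr1 y16]; rewrite ltNge; apply/negP => wy.
set R0 := enorm y in y0 yr1 y16 wy.
have F0 : 0 < R0 `^ (2 - N) by rewrite powR_gt0.
have y4 : R0 < 4^-1 by apply: le_lt_trans y16 _; lra.
have q0 : 0 < 4 * R0 by rewrite mulr_gt0.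
have q4 : 4 * R0 < 1 by rewrite mulrC -ltr_pdivlMr// mul1r.
have R401 : 0 < 4 * R0 < 1 by rewrite q0.
have R01 : 0 < R0 < 1 by rewrite y0/=; apply: lt_trans y4 _; lra.
pose c' := sphere_ratio (4 * R0) `^ (- k).
have c'0 : 0 < c' by rewrite powR_gt0// sphere_ratio_gt0.
have c'A : c - A' < c' by apply: r1P; rewrite q0 mulrC -ler_pdivlMr.
have c'c : c' <= c by rewrite ler_powRN ?sphere_ratio_gt0// ratio_inf_le.
have inner x : enorm (x - y) <= th * R0 -> (c + 2 * sg) * R0 `^ (2 - N) <= u x.
  move=> xy; rewrite sgE -powR_scale//.
  have Ox : Omega x.
    have x1 := ler_enorm_dist y x; have x2 := ler_enorm_dist x y.
    rewrite (enorm_distC y x) -/R0 in x1; rewrite -/R0 in x2.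
    have thR : th * R0 <= 4^-1 * R0 by rewrite ler_pM2r.
    by apply/OmegaE; apply/andP; split; lra.
  rewrite (wK Ox) ler_powRN//.
  - by apply: w_le_near xy => //; rewrite ?th0// -/R0 y0.
  - by rewrite mulr_gt0// powR_gt0.
  - exact: wpos.
have [xE _] := sphere_argmaxP R01; set x := sphere_argmax R0 in xE.
have Ox : Omega x by apply/OmegaE; rewrite xE.
have uxle : u x <= c * R0 `^ (2 - N).
  rewrite (wK Ox) -powR_scale// ler_powRN//.
  - by rewrite -[w x]/(sphere_max R0) (sphere_maxE y0) ler_pM2r ?powR_gt0// ratio_inf_le.
  - exact: wpos.
  - by rewrite mulr_gt0// powR_gt0.
have xfar : th * R0 < enorm (x - y).
  rewrite ltNge; apply/negP => /inner h.
  have := le_trans h uxle; rewrite ler_pM2r// gerDl.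
  by rewrite leNgt mulr_gt0.
have y4' : 0 < enorm y < 4^-1 by rewrite -/R0 y0.
have th4' : 0 < th <= 4^-1 by rewrite th0.
have c'c' : 0 < c' <= c by rewrite c'0.
have outer z : 0 < enorm z <= 4 * enorm y -> c' * enorm z `^ (2 - N) <= u z by exact: u_ge_sphere_ratio.
have := sphere_improvement y4' th4' c'c' sg0 thc inner outer xE xfar.
move=> h; have := le_trans h uxle; rewrite ler_pM2r// -/A'.
by rewrite leNgt -ltrBlDr c'A.
Qed.

End ZeroLimit.

(** * Transfer of the estimates from [w] to [u] *)

Lemma w_ext_holder_ball rho : rho < 1 -> exists2 C, 0 <= C &
  forall x y, enorm x <= rho -> enorm y <= rho -> `|w_ext x - w_ext y| <= C * enorm (x - y) `^ kap.
Proof.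
move=> rho1; have [rho0|rho0] := ltP rho 0.
  by exists 0 => // x y xr; have := le_lt_trans xr rho0; rewrite ltNge enorm_ge0.
(* These choices give (1 + th) rho <= rho' < 1 and th <= 1/2 for every rho in [0, 1). *)
pose rho' := (1 + rho) / 2; pose th := (1 - rho) / 2.
have rho'01 : 0 < rho' < 1 by rewrite /rho'; apply/andP; split; lra.
have th0 : 0 < th <= 2^-1 by rewrite /th; apply/andP; split; lra.
have rr : (1 + th) * rho <= rho' by rewrite /th /rho'; nra.
exists (holder_const th * (sphere_max rho' / rho' `^ kap)).
  apply: mulr_ge0; last by apply: divr_ge0; [exact/ltW/sphere_max_gt0|exact: powR_ge0].
  apply: divr_ge0; last exact: powR_ge0.
  by have := chain_const_ge2; lra.
move=> x y xr yr; apply/ler_normlP; split; rewrite ?opprB lerBlDl.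
  by rewrite enorm_distC; apply: w_ext_holder_le rho'01 th0 rr _ _.
exact: w_ext_holder_le rho'01 th0 rr _ _.
Qed.

Lemma w_ext_continuous x : enorm x < 1 -> {for x, continuous w_ext}.
Proof.
move=> x1; pose rho := (1 + enorm x) / 2; have rho1 : rho < 1 by rewrite /rho; lra.
have xr : enorm x < rho by rewrite /rho; lra.
have [C C0 CP] := w_ext_holder_ball rho1.
have FF : Filter (nbhs x) by exact: nbhs_filter.
apply/(@cvgrPdist_lt _ _ _ (nbhs x) FF) => e e0.
pose d := (e / (C + 1)) `^ kap^-1.
have Cp : 0 < C + 1 by rewrite ltr_wpDl.
have d0 : 0 < d by rewrite powR_gt0// divr_gt0.
apply/nbhs_enorm; exists (Num.min d (rho - enorm x)); first by rewrite lt_min d0 subr_gt0.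
move=> y; rewrite lt_min => /andP[yd yx].
have yr : enorm y < rho by have := ler_enorm_dist y x; lra.
apply: le_lt_trans (CP x y (ltW xr) (ltW yr)) _; rewrite enorm_distC.
have dk : enorm (y - x) `^ kap <= e / (C + 1).
  have -> : e / (C + 1) = d `^ kap.
    by rewrite /d -powRrM mulVf ?powRr1 ?gt_eqF// ltW// divr_gt0.
  by apply: powR_mono; [exact: enorm_ge0|exact: ltW].
apply: (@le_lt_trans _ _ (C * (e / (C + 1)))); first by rewrite ler_wpM2l.
by rewrite mulrA ltr_pdivrMr// mulrC ltr_pM2l// ltrDl.
Qed.

Lemma w_ext_u x : Omega x -> u x = w_ext x `^ (- k).
Proof.
move=> Ox; rewrite (wK Ox) /w_ext; case: eqVneq => [x0|//].
by case: Ox => _ /=; rewrite x0.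
Qed.

(** On the compact set K the continuous [w_ext] has a positive minimum m, and t^(-k) is Lipschitz on
    [m, +oo), so the Hölder bound passes to the power. *)
Lemma holder_norm_finite (K : set 'rV[R]_n) f : compact K -> K `<=` eball 1 ->
  (forall x, K x -> 0 < w_ext x) -> (forall x, K x -> f x = w_ext x `^ (- k)) ->
  (holder_norm kap K f < +oo)%E.
Proof.
move=> compK K1 Kpos fE.
have [K0|/set0P K0] := eqVneq K set0.
  have := @holder_norm_le R n kap 0 0 K f (lexx 0); rewrite K0.
  by move=> h; apply: le_lt_trans (h _ _) _; rewrite ?ltry.
have [x1 Kx1 x1max] : exists2 x, K x & forall y, K y -> - enorm x <= - enorm y.
  apply: lsc_min => // x _ a ax.
  by apply: (cvgr_gt _ (cvgN (@enorm_continuous R n x))).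
have rho1 : enorm x1 < 1 by exact: K1.
have [C C0 CP] := w_ext_holder_ball rho1.
have wc x : K x -> {for x, continuous w_ext} by move=> /K1; exact: w_ext_continuous.
have [xm Kxm xmin] : exists2 x, K x & forall y, K y -> w_ext x <= w_ext y.
  by apply: lsc_min => // x Kx a ax; apply: (cvgr_gt _ (wc x Kx)).
pose m := w_ext xm; have m0 : 0 < m by exact: Kpos.
have L0 : 0 <= k * m `^ (- k - 1) by rewrite mulr_ge0 ?powR_ge0// ltW.
apply: le_lt_trans (ltry (m `^ (- k) + k * m `^ (- k - 1) * C)).
apply: holder_norm_le; first by rewrite mulr_ge0.
  move=> x Kx; rewrite (fE x Kx) (ger0_norm (powR_ge0 _ _)).
  by rewrite (ler_powRN k0 (Kpos x Kx) m0); exact: xmin.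
move=> x y Kx Ky; rewrite !fE//.
apply: le_trans (powRN_lip k0 m0 (xmin _ Kx) (xmin _ Ky)) _.
rewrite -[leRHS]mulrA ler_wpM2l//; apply: CP; rewrite -lerN2; exact: x1max.
Qed.

Lemma w_ext_gt0 x : Omega x -> 0 < w_ext x.
Proof.
move=> Ox; have := wpos Ox; rewrite /w_ext; case: eqVneq => // x0.
by case: Ox => _ /=; rewrite x0.
Qed.

(** |x|^(n - 2) u(x) is the power -k of q = w(x) / |x|^kap, and q is squeezed to [ratio_inf] by
    [ratio_lower] and [ratio_inf_near]. *)
Lemma ratio_cvg : wlim = 0 ->
  enorm x ^+ (n - 2) * u x @[x --> (0 : 'rV[R]_n)^'] --> ratio_inf `^ (- k).
Proof.
move=> wl0; have L0 := ratio_inf_gt0 wl0.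
apply/cvgrPdist_lt => e e0.
have /nbhs_ballP[d /= d0 dP] : \forall t \near ratio_inf, `|ratio_inf `^ (- k) - t `^ (- k)| < e.
  by have /cvgrPdist_lt := @powR_cont _ (- k) _ L0; exact.
pose d1 := Num.min d ratio_inf / 2.
have d1p : 0 < d1 by rewrite divr_gt0// lt_min d0.
have d1d : d1 < d by have : Num.min d ratio_inf <= d; [rewrite ge_min lexx|rewrite /d1; lra].
have d1L : d1 < ratio_inf.
  by have : Num.min d ratio_inf <= ratio_inf; [rewrite ge_min lexx orbT|rewrite /d1; lra].
have [r1 /andP[r10 r11] r1P] := ratio_lower wl0 (introT andP (conj d1p d1L)).
have [r2 /andP[r20 r21] r2P] := ratio_inf_near wl0 d1p.
apply/dnbhs0_enorm; exists (Num.min r1 r2); first by rewrite lt_min r10.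
move=> x /andP[x0]; rewrite lt_min => /andP[xr1 xr2].
have xk : 0 < enorm x `^ kap by rewrite powR_gt0.
have x01 : 0 < enorm x < 1 by rewrite x0/=; exact: lt_trans xr1 r11.
have Ox : Omega x by apply/OmegaE.
pose q := w x / enorm x `^ kap; have q0 : 0 < q by rewrite divr_gt0// wpos.
have wE : w x = q * enorm x `^ kap by rewrite divfK// gt_eqF.
have -> : enorm x ^+ (n - 2) * u x = q `^ (- k).
  rewrite (wK Ox) wE powR_scale// mulrCA -powR_mulrn ?enorm_ge0// -powRD.
    have -> : (n - 2)%:R + (2 - N) = 0 by rewrite natrB ?(ltnW n2)//; rewrite /N; ring.
    by rewrite powRr0 mulr1.
  by rewrite (gt_eqF x0) implybT.
apply: dP; rewrite /ball/= ltr_norml; apply/andP; split.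
  have : q < ratio_inf + d1.
    rewrite /q ltr_pdivrMr//; apply: le_lt_trans (w_le_sphere_ratio wl0 x01 _) _.
      by rewrite x0 lexx.
    by rewrite ltr_pM2r//; apply: r2P; rewrite x0 ltW.
  lra.
have : ratio_inf - d1 < q by rewrite /q ltr_pdivlMr//; apply: r1P; rewrite x0 ltW.
lra.
Qed.

Lemma u_cvg0 : 0 < wlim -> u x @[x --> (0 : 'rV[R]_n)^'] --> wlim `^ (- k).
Proof.
move=> wl0; have w0 : w_ext 0 = wlim by rewrite /w_ext eqxx.
have wc : w_ext x @[x --> (0 : 'rV[R]_n)] --> wlim.
  by rewrite -w0; apply: w_ext_continuous; rewrite enorm0.
have cv : w_ext x `^ (- k) @[x --> (0 : 'rV[R]_n)] --> wlim `^ (- k).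
  exact: (cvg_comp _ _ wc (@powR_cont _ (- k) _ wl0)).
apply/cvgrPdist_lt => e e0; move/cvgrPdist_lt : cv => /(_ e e0) /nbhs_enorm[d d0 dP].
apply/dnbhs0_enorm; exists (Num.min d 1); first by rewrite lt_min d0 ltr01.
move=> x /andP[x0]; rewrite lt_min => /andP[xd x1].
have Ox : Omega x by apply/OmegaE; rewrite x0.
by rewrite (w_ext_u Ox); apply: dP; rewrite subr0.
Qed.

Lemma enorm_exp_cvg0 : enorm x ^+ (n - 2) @[x --> (0 : 'rV[R]_n)^'] --> (0 : R).
Proof.
apply/cvgrPdist_lt => e e0; apply/dnbhs0_enorm; exists (Num.min e 1); first by rewrite lt_min e0 ltr01.
move=> x /andP[x0]; rewrite lt_min => /andP[xe x1].
rewrite sub0r normrN ger0_norm ?exprn_ge0 ?enorm_ge0//.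
apply: le_lt_trans xe; apply: ler_iXnr; rewrite ?enorm_ge0 ?(ltW x1)// subn_gt0//.
Qed.

(** The 1 accounts for the supremum, the other term for the seminorm with th = 1/2 and outer radius
    3/4; both depend on kap alone. *)
Definition estimate_const : R := 1 + holder_const 2^-1 / (3 / 4) `^ kap.

(** If [wlim] = 0, then a is the power -k of [ratio_inf], which is positive, and the last clause is
    void. If [wlim] > 0, then u has a finite limit at 0 and a = 0. *)
Lemma behaviour_at_0 : exists a : R,
  [/\ 0 <= a,
      enorm x ^+ (n - 2) * u x @[x --> (0 : 'rV[R]_n)^'] --> a &
      a = 0 -> exists u0 : R,
        [/\ u0%:E = limf_einf (fun x : 'rV[R]_n => (u x)%:E) (0 : 'rV[R]_n)^',
            holder_loc kap (eball 1) (extend0 u u0) &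
            (holder_norm kap (eball (2^-1)) (fun x => (extend0 u u0 x `^ (- k^-1))%R)
              <= estimate_const%:E * ereal_sup [set (u x `^ (- k^-1))%R%:E | x in esphere (3 / 4)])%E]].
Proof.
have n0 : (0 < n)%N by rewrite (leq_trans _ n2).
have := wlim_ge0; rewrite le_eqVlt => /predU1P[wl0|wl0].
  have L0 : 0 < ratio_inf `^ (- k) by rewrite powR_gt0// ratio_inf_gt0.
  exists (ratio_inf `^ (- k)); split; [exact: ltW|exact: ratio_cvg|].
  by move=> a0; rewrite a0 ltxx in L0.
exists 0; split=> //.
  by rewrite -[X in _ --> X](mul0r (wlim `^ (- k))); apply: cvgM; [exact: enorm_exp_cvg0|exact: u_cvg0].
move=> _; exists (wlim `^ (- k)).
have wtpos x : eball 1 x -> 0 < w_ext x.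
  have [->|x0] := eqVneq x 0; first by rewrite /w_ext eqxx.
  by move=> x1; apply: w_ext_gt0; split => //; exact/eqP.
have extE x : eball 1 x -> extend0 u (wlim `^ (- k)) x = w_ext x `^ (- k).
  rewrite /extend0 => x1; case: eqVneq => [->|x0]; first by rewrite /w_ext eqxx.
  by apply: w_ext_u; split => //; exact/eqP.
split.
- by apply: limf_einf_dnbhs0 => //; exact: u_cvg0.
- by move=> K compK K1; apply: holder_norm_finite => // x /K1; [exact: wtpos|exact: extE].
have q01 : 0 < (3 / 4 : R) < 1 by apply/andP; split; lra.
have h01 : 0 < (2^-1 : R) <= 2^-1 by apply/andP; split; lra.
have rr : (1 + 2^-1 : R) * 2^-1 <= 3 / 4 by lra.
pose S := sphere_max (3 / 4); have S0 : 0 < S by exact: sphere_max_gt0.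
have B0 : 0 <= holder_const 2^-1 * (S / (3 / 4) `^ kap).
  rewrite mulr_ge0// divr_ge0 ?powR_ge0 ?(ltW S0)//.
  by have := chain_const_ge2; lra.
have Ssup : (S%:E <= ereal_sup [set (u x `^ (- k^-1))%R%:E | x in esphere (3 / 4)])%E.
  by apply: ereal_sup_ubound; exists (sphere_argmax (3 / 4)) => //; exact: (sphere_argmaxP q01).1.
have F0 : 0 <= estimate_const.
  have := chain_const_ge2 => h.
  by rewrite addr_ge0// divr_ge0 ?powR_ge0// divr_ge0 ?powR_ge0//; lra.
apply: (@le_trans _ _ (estimate_const%:E * S%:E)%E); last by apply: lee_wpmul2l.
have -> : (estimate_const%:E * S%:E)%E = (S + holder_const 2^-1 * (S / (3 / 4) `^ kap))%:E.
  by rewrite -EFinM /estimate_const; congr _%:E; ring.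
have fE x : eball 2^-1 x -> extend0 u (wlim `^ (- k)) x `^ (- k^-1) = w_ext x.
  move=> x2; have x1 : eball 1 x by rewrite /eball/= in x2 *; lra.
  by rewrite extE// powRNVK// ltW// wtpos.
apply: holder_norm_le => //.
  move=> x x2; rewrite fE//.
  have x1 : eball 1 x by rewrite /eball/= in x2 *; lra.
  rewrite gtr0_norm ?wtpos// /w_ext; case: eqVneq => [_|x0]; first exact: wlim_le.
  by apply: w_le_sphere => //; rewrite enorm_gt0 x0/=; rewrite /eball/= in x2; lra.
move=> x y x2 y2; rewrite !fE//.
have x2' : enorm x <= 2^-1 by exact: ltW.
have y2' : enorm y <= 2^-1 by exact: ltW.
apply/ler_normlP; split; rewrite ?opprB lerBlDl.
  by rewrite enorm_distC; apply: (w_ext_holder_le q01 h01 rr).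
exact: (w_ext_holder_le q01 h01 rr).
Qed.

End Global.

(** * Specialization to kap = 1 - mu and k = (n - 2) / (1 - mu) *)

Unset Implicit Arguments.

Theorem theorem4p6 (R : realType) (n : nat) (hn : (3 <= n)%N)
  (Gamma : set 'rV[R]_n)
  (hGamma : open_convex_symmetric_cone Gamma)
  (hpos : [set lam : 'rV[R]_n | forall i, 0 < lam 0 i] `<=` Gamma)
  (htr : Gamma `<=` [set lam : 'rV[R]_n | 0 < \sum_(i < n) lam 0 i])
  (he1 : ~ topo_boundary Gamma (\row_(j < n) (if j == 0%N :> nat then 1 else 0)))
  (mu : R) (hmu : is_mu_plus Gamma mu) (hmu01 : 0 <= mu < 1) :
  exists C : R, forall u : 'rV[R]_n -> R,
    (forall x, (eball 1 `\ 0) x -> 0 < u x) ->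
    LSC_on (eball 1 `\ 0) u ->
    Linfty_loc (eball 1 `\ 0) u ->
    viscosity_sol Gamma (eball 1 `\ 0) u ->
    holder_loc (1 - mu) (eball 1 `\ 0) u /\
    exists a : R,
      [/\ 0 <= a,
          enorm x ^+ (n - 2) * u x @[x --> (0 : 'rV[R]_n)^'] --> a &
          a = 0 ->
          exists u0 : R,
            [/\ u0%:E = limf_einf (fun x : 'rV[R]_n => (u x)%:E)
                          (0 : 'rV[R]_n)^',
                holder_loc (1 - mu) (eball 1) (extend0 u u0) &
                (holder_norm (1 - mu) (eball (2^-1))
                   (fun x => (extend0 u u0 x `^ ((mu - 1) / (n%:R - 2)))%R)
                 <= C%:E *
                    ereal_sup [set (u x `^ ((mu - 1) / (n%:R - 2)))%R%:E
                              | x in esphere (3 / 4)])%E]].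
Proof.
have mu0 : 0 <= mu by case/andP: hmu01.
have mu1 : mu < 1 by case/andP: hmu01.
have N2 : 0 < (n%:R : R) - 2 by exact: natr_gt2.
pose k : R := (n%:R - 2) / (1 - mu).
have kap0 : 0 < 1 - mu by rewrite subr_gt0.
have kap1 : 1 - mu <= 1 by rewrite gerBl.
have k0 : 0 < k by rewrite divr_gt0.
have kE : k * (1 - mu) = n%:R - 2 by rewrite /k divfK// gt_eqF.
have kV : (mu - 1) / (n%:R - 2) = - k^-1.
  by rewrite /k invf_div -mulNr opprB.
(* The constant is built from mu alone, so Gamma fixes it before u is given. *)
exists (estimate_const (1 - mu)) => u upos ulsc _ hu; rewrite kV.
have OE x : (eball 1 `\ (0 : 'rV[R]_n)) x <-> 0 < enorm x < 1 by exact: OmegaE.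
have oO x : (eball 1 `\ 0) x -> \forall y \near x, (eball 1 `\ (0 : 'rV[R]_n)) y.
  move=> /OE/andP[x0 x1].
  have n1 := @enorm_dist_near R n 0 x 1; have n0 := @enorm_dist_near_gt R n 0 x 0.
  rewrite subr0 in n1 n0; near=> y; apply/OE; apply/andP; split; rewrite -[y]subr0; near: y.
    exact: n0.
  exact: n1.
(* The punctured ball is open, so its subspace neighbourhoods yield neighbourhoods in the whole
   space. *)
have lsc x : (eball 1 `\ 0) x -> forall a, a < u x -> \forall y \near x, a < u y.
  move=> Ox a ax; have [|V] := ulsc x a; first by rewrite lte_fin.
  have -> : nbhs (x : subspace (eball 1 `\ (0 : 'rV[R]_n))) V
      = within (eball 1 `\ 0) (nbhs (x : 'rV[R]_n)) V by rewrite nbhs_subspace_in.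
  move=> nV Va; near=> y.
  have Oy : (eball 1 `\ (0 : 'rV[R]_n)) y by near: y; exact: oO.
  rewrite -lte_fin; apply: Va; move: Oy; near: y; exact: nV.
have CC := cone_comparison hn hGamma hpos hmu mu0 mu1 k0 kE hu upos lsc oO.
have usc := w_usc k0 upos lsc oO.
have SH (D : set 'rV[R]_n) (y : 'rV[R]_n) (al be ga : R) : compact D -> D `<=` eball 1 `\ 0 ->
    ~ D 0 -> ~ D y ->
    (forall x, D x -> al * enorm x `^ (2 - n%:R) + be * enorm (x - y) `^ (2 - n%:R) + ga <= u x
       \/ \forall z \near x, D z) ->
    forall x, D x -> al * enorm x `^ (2 - n%:R) + be * enorm (x - y) `^ (2 - n%:R) + ga <= u x.
  move=> cD DO nD0 nDy bd.
  apply: (superharmonic_comparison hn htr hu upos lsc cD DO nD0 nDy) => //.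
  by move=> x /DO[/= x1 _]; exact: ltW.
split; last exact: (behaviour_at_0 hn k0 kap0 kap1 kE upos usc CC SH).
move=> K sphere_ratio KO; apply: (holder_norm_finite hn k0 kap0 kap1 upos usc CC SH sphere_ratio).
- by move=> x /KO[].
- by move=> x /KO; exact: w_ext_gt0.
- by move=> x /KO; exact: w_ext_u.
Unshelve. all: by end_near. Qed.
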